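(* Let $g(t)=\sum_{k=1}^N\frac{a_k}{t-iw_k}$ with $a_k,w_k\in\mathbb{C}$, $a_k\neq0$, $\Re w_k\neq 0$, and $\Re w_k\neq\Re w_l$ for $k\neq l$. Then $$\Big\{(\alpha,\beta):\ \alpha,\beta>0,\ \alpha\beta\le \tfrac1N\Big\}\subset\mathcal{F}(g).$$
   Context: For $\alpha,\beta>0$, $\mathcal{G}(g;\alpha,\beta)=\{e^{2\pi i\beta n t}g(t-\alpha m)\}_{m,n\in\mathbb{Z}}$; it is a frame in $L^2(\mathbb{R})$ if there are $0<A\le B<\infty$ with $A\|f\|^2\le\sum_{m,n}|\langle f, e^{2\pi i\beta n\cdot}g(\cdot-\alpha m)\rangle|^2\le B\|f\|^2$ for all $f\in L^2(\mathbb{R})$. The frame set $\mathcal{F}(g)$ is the set of all $(\alpha,\beta)$ with $\alpha,\beta>0$ for which $\mathcal{G}(g;\alpha,\beta)$ is a frame. *)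

(* Defs.v *)
From HB Require Import structures.
From mathcomp Require Import all_boot all_order all_algebra.
From mathcomp Require Import all_classical all_reals all_analysis.
From mathcomp Require Import complex.
Set Implicit Arguments. Unset Strict Implicit. Unset Printing Implicit Defensive.
Import Order.TTheory GRing.Theory Num.Theory.
Local Open Scope classical_set_scope.
Local Open Scope ring_scope.

Section Gabor.
Variable R : realType.

Definition cabs2 (z : R[i]) : R := (complex.Re z) ^+ 2 + (complex.Im z) ^+ 2.

Definition ci : R[i] := (0 +i* 1)%C.

Definition cexpi (th : R) : R[i] := (cos th +i* sin th)%C.

Definition L2 (f : R -> R[i]) : Prop :=
  measurable_fun setT (fun t => complex.Re (f t)) /\
  measurable_fun setT (fun t => complex.Im (f t)) /\
  (\int[@lebesgue_measure R]_(t in setT) (cabs2 (f t))%:E < +oo)%E.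

Definition normsq (f : R -> R[i]) : \bar R :=
  (\int[@lebesgue_measure R]_(t in setT) (cabs2 (f t))%:E)%E.

Definition inner (f h : R -> R[i]) : R[i] :=
  (Rintegral (@lebesgue_measure R) setT (fun t => complex.Re (f t * conjc (h t)))
   +i* Rintegral (@lebesgue_measure R) setT (fun t => complex.Im (f t * conjc (h t))))%C.

Definition gabor_atom (g : R -> R[i]) (alpha beta : R) (m n : int) : R -> R[i] :=
  fun t => cexpi (2 * pi * beta * n%:~R * t) * g (t - alpha * m%:~R).

Definition is_gabor_frame (g : R -> R[i]) (alpha beta : R) : Prop :=
  exists A B : R, 0 < A /\ A <= B /\
    forall f, L2 f ->
      let S := (\esum_(mn in [set: int * int])
                 (cabs2 (inner f (gabor_atom g alpha beta mn.1 mn.2)))%:E)%E in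
      (A%:E * normsq f <= S)%E /\ (S <= B%:E * normsq f)%E.

Definition frame_set (g : R -> R[i]) : set (R * R) :=
  [set ab | 0 < ab.1 /\ 0 < ab.2 /\ is_gabor_frame g ab.1 ab.2].

End Gabor.

(* Main.v *)
Require Import Defs.
From HB Require Import structures.
From mathcomp Require Import all_boot all_order all_algebra.
From mathcomp Require Import all_classical all_reals all_analysis.
From mathcomp Require Import complex measurable_realfun.
From mathcomp Require Import ring lra.
Import Order.TTheory GRing.Theory Num.Theory.
Import numFieldNormedType.Exports.
Local Open Scope classical_set_scope.
Local Open Scope ring_scope.

(* Parseval in the frequency index n turns the frame inequality into a uniform
   two-sided estimate, for each t, of the sequence
     S_m = sum_j c_j conj(g (t + j / beta - alpha m)),  c_j = f (t + j / beta),
   by the l^2 norm of c. Put E = exp (2 pi i beta (t - alpha m)) and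
   nu_k = exp (-2 pi beta conj(w_k)). Since
     (nu_k E - 1) / (y + i conj(w_k))
       = 2 pi i int_0^beta exp (2 pi i (y + i conj(w_k)) x) dx
   whenever exp (2 pi i beta y) = E, the product of S_m with prod_k (nu_k E - 1)
   is the m-th Fourier coefficient over [0, 1 / alpha) of a function psi supported
   in [0, N beta), and this interval fits in one period because alpha beta <= 1 / N.
   On each of the N cells of length beta, psi is the trigonometric polynomial
   with coefficients c times an explicit exponential sum, so Parseval, applied
   once in m and once in j, finishes the estimate: the factors nu_k E - 1 are
   bounded away from 0 because |nu_k| <> 1 (Re w_k <> 0), and the N exponential
   sums have no common zero because the |nu_k| are distinct. *)

(** * Complex numbers in coordinates *)

(** The threshold 1/N comes from a degree count. Once the k-th denominator is cleared, the cofactor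
    prod_(l <> k) (nu_l E - 1) has degree N - 1 in E, and each further power of E amounts to a
    translation by [beta] in the dual variable; the N powers therefore occupy N cells, and these
    must not overlap modulo 1/[alpha]. Compactly supported f come first, so that each fibre is a
    finite vector and no convergence in j arises; the constants do not depend on its length. The
    upper bound then extends to all of L2 one finite partial sum at a time. The lower bound does not
    pass through partial sums: it follows by applying the upper bound to the tail of f, at the price
    of a factor 2. In Parseval, Bessel is plain orthogonality; the other half is completeness,
    obtained by duality. Bounded coefficient sums control the pairing of F with trigonometric
    polynomials, hence with their bounded almost everywhere limits, hence with step functions.
    Testing against the cell averages of F bounds their norm, and the averages converge to F by
    Lebesgue differentiation. *)

Section ComplexAlgebra.
Variable R : realType.
Implicit Types (x y z : R[i]) (a b t : R).

Lemma complex_ext z z' : complex.Re z = complex.Re z' ->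
  complex.Im z = complex.Im z' -> z = z'.
Proof. by case: z z' => [? ?] [? ?] /= -> ->. Qed.

Lemma cReM x y : complex.Re (x * y) =
  complex.Re x * complex.Re y - complex.Im x * complex.Im y.
Proof. by case: x y => [? ?] [? ?]. Qed.

Lemma cImM x y : complex.Im (x * y) =
  complex.Re x * complex.Im y + complex.Im x * complex.Re y.
Proof. by case: x y => [? ?] [? ?]. Qed.

Lemma cReJ x : complex.Re (conjc x) = complex.Re x.
Proof. by case: x. Qed.

Lemma cImJ x : complex.Im (conjc x) = - complex.Im x.
Proof. by case: x. Qed.

Lemma cReD x y : complex.Re (x + y) = complex.Re x + complex.Re y.
Proof. by case: x y => [? ?] [? ?]. Qed.

Lemma cImD x y : complex.Im (x + y) = complex.Im x + complex.Im y.
Proof. by case: x y => [? ?] [? ?]. Qed.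

Lemma cReN x : complex.Re (- x) = - complex.Re x.
Proof. by case: x. Qed.

Lemma cImN x : complex.Im (- x) = - complex.Im x.
Proof. by case: x. Qed.

Lemma cRe_sum (I : Type) (r : seq I) (P : pred I) (F : I -> R[i]) :
  complex.Re (\sum_(i <- r | P i) F i) = \sum_(i <- r | P i) complex.Re (F i).
Proof. exact: (big_morph _ cReD). Qed.

Lemma cIm_sum (I : Type) (r : seq I) (P : pred I) (F : I -> R[i]) :
  complex.Im (\sum_(i <- r | P i) F i) = \sum_(i <- r | P i) complex.Im (F i).
Proof. exact: (big_morph _ cImD). Qed.

Lemma conjcM x y : conjc (x * y) = conjc x * conjc y.
Proof. exact: (rmorphM conjc). Qed.

Lemma conjcD x y : conjc (x + y) = conjc x + conjc y.
Proof. exact: (rmorphD conjc). Qed.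

Lemma conjcB x y : conjc (x - y) = conjc x - conjc y.
Proof. exact: (rmorphB conjc). Qed.

Lemma conjc_sum (I : Type) (r : seq I) (P : pred I) (F : I -> R[i]) :
  conjc (\sum_(i <- r | P i) F i) = \sum_(i <- r | P i) conjc (F i).
Proof. exact: (rmorph_sum conjc). Qed.

Lemma cabs2E z : (cabs2 z)%:C%C = z * conjc z.
Proof. by apply: complex_ext; rewrite ?cReM ?cImM ?cReJ ?cImJ /cabs2 /=; ring. Qed.

Lemma cabs2_ge0 z : 0 <= cabs2 z.
Proof. by rewrite addr_ge0 ?sqr_ge0. Qed.

Lemma cabs2M x y : cabs2 (x * y) = cabs2 x * cabs2 y.
Proof. by rewrite /cabs2 cReM cImM; ring. Qed.

Lemma cabs2J z : cabs2 (conjc z) = cabs2 z.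
Proof. by rewrite /cabs2 cReJ cImJ sqrrN. Qed.

Lemma cabs2N z : cabs2 (- z) = cabs2 z.
Proof. by rewrite /cabs2 cReN cImN !sqrrN. Qed.

Lemma cabs20 : cabs2 (0 : R[i]) = 0.
Proof. by rewrite /cabs2 /= expr0n addr0. Qed.

Lemma cabs21 : cabs2 (1 : R[i]) = 1.
Proof. by rewrite /cabs2 /= expr1n expr0n addr0. Qed.

Lemma cabs2_real a : cabs2 (a%:C%C : R[i]) = a ^+ 2.
Proof. by rewrite /cabs2 /= expr0n addr0. Qed.

Lemma cabs2_eq0 z : (cabs2 z == 0) = (z == 0).
Proof. by rewrite /cabs2 paddr_eq0 ?sqr_ge0// !sqrf_eq0 eq_complex. Qed.

Lemma cabs2_gt0 z : (0 < cabs2 z) = (z != 0).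
Proof. by rewrite lt_def cabs2_ge0 andbT cabs2_eq0. Qed.

Lemma cabs2_prod (I : Type) (r : seq I) (P : pred I) (F : I -> R[i]) :
  cabs2 (\prod_(i <- r | P i) F i) = \prod_(i <- r | P i) cabs2 (F i).
Proof. exact: (big_morph _ cabs2M cabs21). Qed.

Lemma cabs2D_le x y : cabs2 (x + y) <= 2 * cabs2 x + 2 * cabs2 y.
Proof.
rewrite -subr_ge0 (_ : _ - _ = cabs2 (x - y)) ?cabs2_ge0//.
by rewrite /cabs2 !cReD !cImD cReN cImN; ring.
Qed.

Lemma cabs2B_le x y : cabs2 (x - y) <= 2 * cabs2 x + 2 * cabs2 y.
Proof. by rewrite (le_trans (cabs2D_le _ _))// cabs2N. Qed.

Lemma Re2_le_cabs2 z : complex.Re z ^+ 2 <= cabs2 z.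
Proof. by rewrite lerDl sqr_ge0. Qed.

(** The constant is not sharp; the bound only has to supply an integrable dominating function for a
    product of two L2 functions. *)
Lemma norm_Re_mulJ x y : `|complex.Re (x * conjc y)| <= cabs2 x + cabs2 y.
Proof.
case: x y => [a b] [c d]; rewrite cReM cReJ cImJ /cabs2 /= ler_norml.
have := sqr_ge0 (a + c); have := sqr_ge0 (a - c).
have := sqr_ge0 (b + d); have := sqr_ge0 (b - d).
have := sqr_ge0 a; have := sqr_ge0 b; have := sqr_ge0 c; have := sqr_ge0 d.
by rewrite !expr2 => *; apply/andP; split; lra.
Qed.

Lemma norm_Im_mulJ x y : `|complex.Im (x * conjc y)| <= cabs2 x + cabs2 y.
Proof.
case: x y => [a b] [c d]; rewrite cImM cReJ cImJ /cabs2 /= ler_norml.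
have := sqr_ge0 (a + d); have := sqr_ge0 (a - d).
have := sqr_ge0 (b + c); have := sqr_ge0 (b - c).
have := sqr_ge0 a; have := sqr_ge0 b; have := sqr_ge0 c; have := sqr_ge0 d.
by rewrite !expr2 => *; apply/andP; split; lra.
Qed.

(** Cauchy-Schwarz by completing the square: sum |A G_i - p conj(F_i)|^2 equals A (A B - |p|^2). If
    A = 0 every F_i vanishes, and so does p. *)
Lemma cabs2_sum_mul (I : Type) (r : seq I) (F G : I -> R[i]) :
  cabs2 (\sum_(i <- r) F i * G i) <=
  (\sum_(i <- r) cabs2 (F i)) * (\sum_(i <- r) cabs2 (G i)).
Proof.
set p := \sum_(i <- r) F i * G i; set A := \sum_(i <- r) cabs2 (F i).
set B := \sum_(i <- r) cabs2 (G i).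
have A0 : 0 <= A by apply: sumr_ge0 => i _; exact: cabs2_ge0.
have : 0 <= \sum_(i <- r) cabs2 (A%:C%C * G i - p * conjc (F i)).
  by apply: sumr_ge0 => i _; exact: cabs2_ge0.
have -> : \sum_(i <- r) cabs2 (A%:C%C * G i - p * conjc (F i)) =
    A * (A * B - cabs2 p).
  apply: complexI; rewrite rmorph_sum /=.
  under eq_bigr do rewrite cabs2E conjcB !conjcM conjc_real conjcK.
  transitivity (\sum_(i <- r) (A%:C%C * A%:C%C * (cabs2 (G i))%:C%C
    - A%:C%C * conjc p * (F i * G i) - A%:C%C * p * conjc (F i * G i)
     + p * conjc p * (cabs2 (F i))%:C%C)).
    apply: eq_bigr => i _; rewrite !cabs2E conjcM.
    by ring.
  rewrite big_split/= !sumrB -!mulr_sumr -!rmorph_sum -/A -/B.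
  have -> : (A * (A * B - cabs2 p))%:C%C =
      A%:C%C * (A%:C%C * B%:C%C - p * conjc p) :> R[i].
    by rewrite -cabs2E !(rmorphM, rmorphB).
  change (A%:C%C * A%:C%C * B%:C%C - A%:C%C * conjc p * p -
    A%:C%C * p * conjc p + p * conjc p * A%:C%C =
    A%:C%C * (A%:C%C * B%:C%C - p * conjc p)).
  by ring.
have [A_gt0|A_le0] := ltP 0 A.
  by rewrite pmulr_rge0// subr_ge0.
have A00 : A = 0 by apply/eqP; rewrite eq_le A_le0.
move=> _; rewrite A00 mul0r.
suff -> : p = 0 by rewrite cabs20.
rewrite /p {}/p {B}.
move: A00; rewrite /A {A A0 A_le0}; elim: r => [|i r IH]; first by rewrite !big_nil.
rewrite !big_cons => /eqP; rewrite paddr_eq0 ?cabs2_ge0//; last first.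
  by apply: sumr_ge0 => j _; exact: cabs2_ge0.
by move=> /andP[]; rewrite cabs2_eq0 => /eqP -> /eqP /IH ->; rewrite mul0r addr0.
Qed.

Lemma cabs2_sum_le n (F : 'I_n -> R[i]) :
  cabs2 (\sum_(i < n) F i) <= n%:R * \sum_(i < n) cabs2 (F i).
Proof.
have := cabs2_sum_mul _ (index_enum 'I_n) (fun _ => 1) F.
under eq_bigr do rewrite mul1r.
by under [X in X * _]eq_bigr do rewrite cabs21; rewrite sumr_const card_ord.
Qed.

Definition cexp z : R[i] :=
  Complex (expR (complex.Re z) * cos (complex.Im z))
          (expR (complex.Re z) * sin (complex.Im z)).

Lemma cexpD x y : cexp (x + y) = cexp x * cexp y.
Proof.
by apply: complex_ext; rewrite ?cReM ?cImM /= cReD cImD expRD ?cosD ?sinD; ring.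
Qed.

Lemma cexp0 : cexp 0 = 1.
Proof. by apply: complex_ext; rewrite /= expR0 ?cos0 ?sin0 ?mulr1 ?mulr0. Qed.

Lemma cabs2_cexp z : cabs2 (cexp z) = expR (2 * complex.Re z).
Proof.
have h := cos2Dsin2 (complex.Im z).
rewrite /cabs2 /= !exprMn -mulrDr h mulr1 -expRM_natl; congr expR.
Qed.

Lemma cexp_neq0 z : cexp z != 0.
Proof. by rewrite -cabs2_gt0 cabs2_cexp expR_gt0. Qed.

Lemma cexpiE t : cexpi t = cexp (ci R * t%:C%C).
Proof.
rewrite /cexp; have -> : complex.Re (ci R * t%:C%C) = 0 by rewrite cReM /=; ring.
have -> : complex.Im (ci R * t%:C%C) = t by rewrite cImM /=; ring.
by rewrite expR0 !mul1r.
Qed.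

Lemma cexpiD s t : cexpi (s + t) = cexpi s * cexpi t.
Proof. by rewrite !cexpiE rmorphD mulrDr cexpD. Qed.

Lemma cexpi0 : cexpi (0 : R) = 1.
Proof. by rewrite /cexpi cos0 sin0. Qed.

Lemma cexpiN t : cexpi (- t) = conjc (cexpi t).
Proof. by rewrite /cexpi cosN sinN. Qed.

Lemma cabs2_cexpi t : cabs2 (cexpi t) = 1.
Proof. by rewrite /cabs2 /= cos2Dsin2. Qed.

Lemma cexpi_nat (n : nat) : cexpi (2 * pi * n%:R) = 1 :> R[i].
Proof.
elim: n => [|n IH]; first by rewrite mulr0 cexpi0.
rewrite -[n.+1%:R]natr1 mulrDr mulr1 cexpiD IH mul1r /cexpi mulr_natl.
by rewrite -[pi *+ 2]add0r cosD2pi sinD2pi cos0 sin0.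
Qed.

Lemma cexpi_int (n : int) : cexpi (2 * pi * n%:~R) = 1 :> R[i].
Proof.
case: n => n; first exact: cexpi_nat.
by rewrite NegzE mulrNz mulrN cexpiN cexpi_nat /= oppr0.
Qed.

End ComplexAlgebra.
Arguments cexp {R} z.

(** * Integrals of complex-valued functions *)

Section ComplexIntegral.
Variable R : realType.
Local Notation mu := (@lebesgue_measure R).
Implicit Types (F G : R -> R[i]) (D : set (measurableTypeR R)) (z : R[i]).

Definition cmeas D F := measurable_fun D (fun t => complex.Re (F t)) /\
  measurable_fun D (fun t => complex.Im (F t)).

Definition cintg D F := mu.-integrable D (EFin \o (fun t => complex.Re (F t))) /\
  mu.-integrable D (EFin \o (fun t => complex.Im (F t))).

Definition cint D F : R[i] :=
  Complex (Rintegral mu D (fun t => complex.Re (F t)))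
          (Rintegral mu D (fun t => complex.Im (F t))).

(** Relative to a set, so that one notion serves the line, the periods and the cells. *)
Definition cL2 D F := cmeas D F /\ (\int[mu]_(t in D) (cabs2 (F t))%:E < +oo)%E.

(** Real-valued, hence 0 when the integral is infinite; [nsqE] therefore asks for [cL2]. *)
Definition nsq D F : R := Rintegral mu D (fun t => cabs2 (F t)).

Lemma eq_cmeas D F G : (forall t, D t -> F t = G t) -> cmeas D F -> cmeas D G.
Proof.
by move=> FG [mr mi]; split; [apply: eq_measurable_fun mr|apply: eq_measurable_fun mi];
  move=> t /set_mem Dt; rewrite FG.
Qed.

Lemma cmeas_cst D z : cmeas D (fun=> z).
Proof. by split; exact: measurable_cst. Qed.

Lemma cmeasD D F G : cmeas D F -> cmeas D G -> cmeas D (fun t => F t + G t).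
Proof.
move=> [fr fi] [gr gi]; split.
  by apply: eq_measurable_fun (measurable_funD fr gr) => t _; rewrite cReD.
by apply: eq_measurable_fun (measurable_funD fi gi) => t _; rewrite cImD.
Qed.

Lemma cmeasM D F G : cmeas D F -> cmeas D G -> cmeas D (fun t => F t * G t).
Proof.
move=> [fr fi] [gr gi]; split.
  apply: eq_measurable_fun
    (measurable_funB (measurable_funM fr gr) (measurable_funM fi gi)) => t _.
  by rewrite cReM.
apply: eq_measurable_fun
  (measurable_funD (measurable_funM fr gi) (measurable_funM fi gr)) => t _.
by rewrite cImM.
Qed.

Lemma cmeasJ D F : measurable D -> cmeas D F -> cmeas D (fun t => conjc (F t)).
Proof.
move=> mD [fr fi]; split.
  by apply: eq_measurable_fun fr => t _; rewrite cReJ.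
have : measurable_fun D (\- (fun t => complex.Im (F t))) by exact: measurableT_comp.
by apply: eq_measurable_fun => t _; rewrite cImJ.
Qed.

Lemma cmeas_sum D (I : Type) (r : seq I) (F : I -> R -> R[i]) :
  (forall i, cmeas D (F i)) -> cmeas D (fun t => \sum_(i <- r) F i t).
Proof.
move=> mF; elim: r => [|i r IH].
  by apply: eq_cmeas (cmeas_cst D 0) => t _; rewrite big_nil.
by apply: eq_cmeas (cmeasD D _ _ (mF i) IH) => t _; rewrite big_cons.
Qed.

Lemma cmeasS D D' F : measurable D -> D' `<=` D -> cmeas D F -> cmeas D' F.
Proof. by move=> mD DD' [fr fi]; split; [move: fr|move: fi]; exact: measurable_funS. Qed.

Lemma cmeas_continuous D F : measurable D ->
  continuous (fun t => complex.Re (F t)) ->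
  continuous (fun t => complex.Im (F t)) -> cmeas D F.
Proof.
by move=> mD cr ci; split; apply: measurable_funTS; exact: continuous_measurable_fun.
Qed.

Lemma measurable_cabs2 D F : cmeas D F -> measurable_fun D (fun t => cabs2 (F t)).
Proof.
by move=> [fr fi]; rewrite /cabs2; apply: measurable_funD; exact: measurable_funX.
Qed.

Lemma measurable_cabs2E D F : cmeas D F ->
  measurable_fun D (fun t => (cabs2 (F t))%:E).
Proof. by move=> mF; apply/measurable_EFinP; exact: measurable_cabs2. Qed.

Lemma cintg_meas D F : cintg D F -> cmeas D F.
Proof.
by move=> [/measurable_int/measurable_EFinP ? /measurable_int/measurable_EFinP ?].
Qed.

Lemma eq_cintg D F G : measurable D ->
  (forall t, D t -> F t = G t) -> cintg D F -> cintg D G.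
Proof.
by move=> mD FG [ir ii]; split;
  [apply: (eq_integrable mD _ _ _ ir)|apply: (eq_integrable mD _ _ _ ii)] => //;
  move=> t /set_mem Dt /=; rewrite FG.
Qed.

Lemma eq_cint D F G : (forall t, D t -> F t = G t) -> cint D F = cint D G.
Proof.
by move=> FG; congr Complex; apply: eq_Rintegral => t /set_mem /FG ->.
Qed.

Lemma cintgD D F G : measurable D -> cintg D F -> cintg D G ->
  cintg D (fun t => F t + G t).
Proof.
move=> mD [fr fi] [gr gi]; split.
  by apply: (eq_integrable mD _ _ _ (integrableD mD fr gr)) => // t _ /=; rewrite cReD.
by apply: (eq_integrable mD _ _ _ (integrableD mD fi gi)) => // t _ /=; rewrite cImD.
Qed.

Lemma cintD D F G : measurable D -> cintg D F -> cintg D G ->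
  cint D (fun t => F t + G t) = cint D F + cint D G.
Proof.
move=> mD [fr fi] [gr gi]; apply: complex_ext; rewrite ?cReD ?cImD /=.
  by rewrite -RintegralD//; apply: eq_Rintegral => t _; rewrite cReD.
by rewrite -RintegralD//; apply: eq_Rintegral => t _; rewrite cImD.
Qed.

Lemma cintgZ D F z : measurable D -> cintg D F -> cintg D (fun t => z * F t).
Proof.
move=> mD [fr fi]; split.
  apply: (eq_integrable mD _ _ _ (integrableB mD (integrableZl mD (complex.Re z) fr)
    (integrableZl mD (complex.Im z) fi))) => // t _ /=.
  by rewrite cReM.
apply: (eq_integrable mD _ _ _ (integrableD mD (integrableZl mD (complex.Re z) fi)
    (integrableZl mD (complex.Im z) fr))) => // t _ /=.
by rewrite cImM.
Qed.

Lemma cintZ D F z : measurable D -> cintg D F ->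
  cint D (fun t => z * F t) = z * cint D F.
Proof.
move=> mD [fr fi].
have iZ r (f : R -> R) : mu.-integrable D (EFin \o f) ->
    mu.-integrable D (EFin \o (fun t => r * f t)).
  by move=> /(integrableZl mD r); apply: eq_integrable.
apply: complex_ext; rewrite ?cReM ?cImM /=.
  rewrite -!RintegralZl// -RintegralB//; [|exact: iZ..].
  by apply: eq_Rintegral => t _; rewrite cReM.
rewrite -!RintegralZl// -RintegralD//; [|exact: iZ..].
by apply: eq_Rintegral => t _; rewrite cImM.
Qed.

Lemma cintg0 D : measurable D -> cintg D (fun=> 0).
Proof. by move=> mD; split; exact: integrable0. Qed.

Lemma cint0 D : cint D (fun=> 0) = 0.
Proof. by apply: complex_ext; rewrite /= /Rintegral integral0. Qed.

Lemma cintg_sum D (I : Type) (r : seq I) (F : I -> R -> R[i]) : measurable D ->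
  (forall i, cintg D (F i)) -> cintg D (fun t => \sum_(i <- r) F i t).
Proof.
move=> mD mF; elim: r => [|i r IH].
  by apply: eq_cintg (cintg0 D mD) => // t _; rewrite big_nil.
by apply: eq_cintg (cintgD D _ _ mD (mF i) IH) => // t _; rewrite big_cons.
Qed.

Lemma cint_sum D (I : Type) (r : seq I) (F : I -> R -> R[i]) : measurable D ->
  (forall i, cintg D (F i)) ->
  cint D (fun t => \sum_(i <- r) F i t) = \sum_(i <- r) cint D (F i).
Proof.
move=> mD mF; elim: r => [|i r IH].
  by rewrite big_nil -[RHS](cint0 D); apply: eq_cint => t _; rewrite big_nil.
rewrite big_cons -IH -cintD//; last exact: cintg_sum.
by apply: eq_cint => t _; rewrite big_cons.
Qed.

Lemma cintB D F G : measurable D -> cintg D F -> cintg D G ->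
  cint D (fun t => F t - G t) = cint D F - cint D G.
Proof.
move=> mD iF iG; rewrite -mulN1r -cintZ// -cintD//; last exact: cintgZ.
by apply: eq_cint => t _; rewrite mulN1r.
Qed.

Lemma cintJ D F : measurable D -> cintg D F ->
  cint D (fun t => conjc (F t)) = conjc (cint D F).
Proof.
move=> mD [fr fi]; apply: complex_ext; rewrite ?cReJ ?cImJ /=.
  by apply: eq_Rintegral => t _; rewrite cReJ.
rewrite -mulN1r -RintegralZl//; apply: eq_Rintegral => t _.
by rewrite cImJ mulN1r.
Qed.

Lemma cL2_meas D F : cL2 D F -> cmeas D F. Proof. by case. Qed.

Lemma cL2_integrable D F : measurable D -> cL2 D F ->
  mu.-integrable D (fun t => (cabs2 (F t))%:E).
Proof.
move=> mD [mF iF]; apply/integrableP; split; first exact: measurable_cabs2E.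
by under eq_integral do rewrite gee0_abs ?lee_fin ?cabs2_ge0//.
Qed.

Lemma ge0_le_integralR D (f g : R -> R) : measurable D ->
  measurable_fun D f -> measurable_fun D g ->
  (forall t, D t -> 0 <= f t) -> (forall t, D t -> f t <= g t) ->
  (\int[mu]_(t in D) (f t)%:E <= \int[mu]_(t in D) (g t)%:E)%E.
Proof.
move=> mD mf mg f0 fg.
apply: (ge0_le_integral mu mD (f1 := EFin \o f) (f2 := EFin \o g)).
- by move=> t Dt; rewrite lee_fin f0.
- exact/measurable_EFinP.
- exact/measurable_EFinP.
- by move=> t Dt; rewrite lee_fin fg.
Qed.

Lemma ge0_integralZlR D (k : R) (f : R -> R) : measurable D -> measurable_fun D f ->
  (forall t, D t -> 0 <= f t) -> 0 <= k ->
  (\int[mu]_(t in D) (k * f t)%:E = k%:E * \int[mu]_(t in D) (f t)%:E)%E.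
Proof.
move=> mD mf f0 k0; under eq_integral do rewrite EFinM.
apply: (ge0_integralZl mu mD (f := EFin \o f)) => //.
exact/measurable_EFinP.
Qed.

Lemma ge0_integralDR D (f g : R -> R) : measurable D -> measurable_fun D f ->
  measurable_fun D g -> (forall t, D t -> 0 <= f t) -> (forall t, D t -> 0 <= g t) ->
  (\int[mu]_(t in D) (f t + g t)%:E =
   \int[mu]_(t in D) (f t)%:E + \int[mu]_(t in D) (g t)%:E)%E.
Proof.
move=> mD mf mg f0 g0; under eq_integral do rewrite EFinD.
apply: (ge0_integralD mu mD (f1 := EFin \o f) (f2 := EFin \o g)) => //;
  exact/measurable_EFinP.
Qed.

Lemma nsqE D F : measurable D -> cL2 D F ->
  (\int[mu]_(t in D) (cabs2 (F t))%:E = (nsq D F)%:E)%E.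
Proof.
by move=> mD /(cL2_integrable D F mD) iF; rewrite /nsq /Rintegral fineK// integrable_fin_num.
Qed.

Lemma nsq_ge0 D F : 0 <= nsq D F.
Proof. by apply: Rintegral_ge0 => t _; exact: cabs2_ge0. Qed.

Lemma cL2_le D F G (K : R) : measurable D -> cmeas D G -> cL2 D F -> 0 <= K ->
  (forall t, D t -> cabs2 (G t) <= K * cabs2 (F t)) -> cL2 D G.
Proof.
move=> mD mG [mF iF] K0 GF; split=> //.
have mF2 := measurable_cabs2 D F mF.
apply: (@le_lt_trans _ _ (\int[mu]_(t in D) (K * cabs2 (F t))%:E)%E).
  apply: ge0_le_integralR => //; [exact: measurable_cabs2|exact: measurable_funM|].
  by move=> t _; exact: cabs2_ge0.
rewrite ge0_integralZlR//; last by move=> t _; exact: cabs2_ge0.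
by rewrite lte_mul_pinfty.
Qed.

Lemma cL2D D F G : measurable D -> cL2 D F -> cL2 D G -> cL2 D (fun t => F t + G t).
Proof.
move=> mD [mF iF] [mG iG]; split; first exact: cmeasD.
have mF2 := measurable_cabs2 D F mF; have mG2 := measurable_cabs2 D G mG.
have m2 (f : R -> R) : measurable_fun D f -> measurable_fun D (fun t => 2 * f t).
  by move=> mf; exact: measurable_funM.
apply: (@le_lt_trans _ _ (\int[mu]_(t in D) (2 * cabs2 (F t) + 2 * cabs2 (G t))%:E)%E).
  apply: ge0_le_integralR => //.
  - by apply: measurable_cabs2; exact: cmeasD.
  - by apply: measurable_funD; exact: m2.
  - by move=> t _; exact: cabs2_ge0.
  - by move=> t _; exact: cabs2D_le.
have p2 H t : 0 <= 2 * cabs2 (H t : R[i]) by rewrite mulr_ge0 ?cabs2_ge0.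
rewrite ge0_integralDR//; [|exact: m2..].
rewrite !ge0_integralZlR//; try by move=> t _; exact: cabs2_ge0.
by rewrite lte_add_pinfty// lte_mul_pinfty.
Qed.

Lemma eq_cL2 D F G : (forall t, D t -> F t = G t) -> cL2 D F -> cL2 D G.
Proof.
move=> FG [mF iF]; split; first exact: eq_cmeas mF.
suff <- : (\int[mu]_(t in D) (cabs2 (F t))%:E = \int[mu]_(t in D) (cabs2 (G t))%:E)%E by [].
by apply: eq_integral => t /set_mem /FG ->.
Qed.

Lemma cL2_0 D : cL2 D (fun=> 0).
Proof.
split; first exact: cmeas_cst.
by under eq_integral do rewrite cabs20; rewrite integral0.
Qed.

Lemma cL2_sum D (I : Type) (r : seq I) (F : I -> R -> R[i]) : measurable D ->
  (forall i, cL2 D (F i)) -> cL2 D (fun t => \sum_(i <- r) F i t).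
Proof.
move=> mD mF; elim: r => [|i r IH].
  by apply: eq_cL2 (cL2_0 D) => t _; rewrite big_nil.
by apply: eq_cL2 (cL2D D _ _ mD (mF i) IH) => t _; rewrite big_cons.
Qed.

Lemma cL2_bndM D F G (K : R) : measurable D -> cL2 D F -> cmeas D G ->
  (forall t, D t -> cabs2 (G t) <= K) -> cL2 D (fun t => G t * F t).
Proof.
move=> mD lF mG GK; have mF := cL2_meas _ _ lF.
apply: (cL2_le D F _ `|K|) => //; first exact: cmeasM.
move=> t Dt; rewrite cabs2M ler_wpM2r ?cabs2_ge0//.
by rewrite (le_trans (GK t Dt)) ?ler_norm.
Qed.

Lemma cL2Z D F z : measurable D -> cL2 D F -> cL2 D (fun t => z * F t).
Proof. by move=> mD lF; apply: (cL2_bndM D F _ (cabs2 z)) => //; exact: cmeas_cst. Qed.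

Lemma cL2_bnd D G (K : R) : measurable D -> (mu D < +oo)%E -> cmeas D G ->
  (forall t, D t -> cabs2 (G t) <= K) -> cL2 D G.
Proof.
move=> mD Dfin mG GK; split=> //.
apply: (@le_lt_trans _ _ (\int[mu]_(t in D) `|K|%:E)%E).
  apply: ge0_le_integralR => //; first exact: measurable_cabs2.
    by move=> t _; exact: cabs2_ge0.
  by move=> t Dt; rewrite (le_trans (GK t Dt)) ?ler_norm.
by rewrite integral_cst// lte_mul_pinfty// lee_fin.
Qed.

Lemma cL2_cintg D F G : measurable D -> cL2 D F -> cL2 D G ->
  cintg D (fun t => F t * conjc (G t)).
Proof.
move=> mD lF lG; have mF := cL2_meas _ _ lF; have mG := cL2_meas _ _ lG.
have [mr mi] : cmeas D (fun t => F t * conjc (G t)).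
  by apply: cmeasM => //; exact: cmeasJ.
have iFG := integrableD mD (cL2_integrable D F mD lF) (cL2_integrable D G mD lG).
split; apply: (le_integrable mD _ _ iFG); try exact/measurable_EFinP.
  move=> t _ /=; rewrite lee_fin (le_trans (norm_Re_mulJ _ _ _))//.
  by rewrite ger0_norm// addr_ge0 ?cabs2_ge0.
move=> t _ /=; rewrite lee_fin (le_trans (norm_Im_mulJ _ _ _))//.
by rewrite ger0_norm// addr_ge0 ?cabs2_ge0.
Qed.

(** Through this equation, norm identities are derived from the complex linearity of [cint] and then
    read back in the reals with [complexI]. *)
Lemma cint_nsq D F : cint D (fun t => F t * conjc (F t)) = (nsq D F)%:C%C.
Proof.
apply: complex_ext => /=.
  by apply: eq_Rintegral => t _; rewrite -cabs2E.
by under eq_Rintegral do rewrite -cabs2E /=; rewrite /Rintegral integral0.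
Qed.

Lemma cL2S D D' F : measurable D -> measurable D' -> D' `<=` D -> cL2 D F -> cL2 D' F.
Proof.
move=> mD mD' DD' [mF iF]; split; first exact: cmeasS mF.
apply: le_lt_trans iF; apply: ge0_subset_integral => //.
- exact: measurable_cabs2E.
- by move=> t _; rewrite lee_fin cabs2_ge0.
Qed.

End ComplexIntegral.
Arguments cmeas {R} D F.
Arguments cintg {R} D F.
Arguments cint {R} D F.
Arguments cL2 {R} D F.
Arguments nsq {R} D F.

(** * Integrals of complex exponentials *)

Section Exponentials.
Variable R : realType.
Local Notation mu := (@lebesgue_measure R).

(** Half-open intervals tile the line without overlap; the endpoint is a null set. The case a = b is
    split off because the fundamental theorem wants a < b. *)
Lemma Rintegral_FTC (f F : R -> R) (a b : R) : a <= b ->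
  (forall x : R, is_derive x (1:R) F (f x)) -> continuous f ->
  mu.-integrable `[a, b[ (EFin \o f) /\ Rintegral mu `[a, b[ f = F b - F a.
Proof.
move=> ab dF cf.
have icc : mu.-integrable `[a, b] (EFin \o f).
  apply: continuous_compact_integrable; first exact: segment_compact.
  exact: continuous_subspaceT.
have ico : mu.-integrable `[a, b[ (EFin \o f).
  apply: integrableS icc => //; apply: subset_itvl.
  by rewrite bnd_simp.
split=> //; rewrite Rintegral_itv_bndo_bndc//.
move: ab; rewrite le_eqVlt => /predU1P[<-|ab].
  by rewrite set_itv1 Rintegral_set1 subrr.
have cF : continuous F by move=> x; apply: differentiable_continuous; apply/derivable1_diffP.
rewrite /Rintegral (continuous_FTC2 ab _ _ (F := F))//.
- exact: continuous_subspaceT.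
- split.
  + by move=> x _.
  + by apply: cvg_at_right_filter; exact: cF.
  + by apply: cvg_at_left_filter; exact: cF.
- by move=> x _; rewrite derive1E derive_val.
Qed.

Lemma cexp_lin (z : R[i]) (t : R) : cexp (z * t%:C%C) =
  Complex (expR (complex.Re z * t) * cos (complex.Im z * t))
          (expR (complex.Re z * t) * sin (complex.Im z * t)).
Proof.
by rewrite /cexp cReM cImM /= !mulr0 subr0 add0r.
Qed.

Lemma continuous_expM (p : R) : continuous (fun t : R => expR (p * t)).
Proof. by move=> t; apply: continuous_comp; [exact: mulrl_continuous|exact: continuous_expR]. Qed.

Lemma continuous_cosM (p : R) : continuous (fun t : R => cos (p * t)).
Proof. by move=> t; apply: continuous_comp; [exact: mulrl_continuous|exact: continuous_cos]. Qed.

Lemma continuous_sinM (p : R) : continuous (fun t : R => sin (p * t)).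
Proof. by move=> t; apply: continuous_comp; [exact: mulrl_continuous|exact: continuous_sin]. Qed.

Lemma continuous_Re_cexp (z : R[i]) :
  continuous (fun t : R => complex.Re (cexp (z * t%:C%C))).
Proof.
have -> : (fun t : R => complex.Re (cexp (z * t%:C%C))) =
    (fun t => expR (complex.Re z * t) * cos (complex.Im z * t)).
  by apply/funext => t; rewrite cexp_lin.
move=> t; exact: (continuousM (continuous_expM (complex.Re z) t)
  (continuous_cosM (complex.Im z) t)).
Qed.

Lemma continuous_Im_cexp (z : R[i]) :
  continuous (fun t : R => complex.Im (cexp (z * t%:C%C))).
Proof.
have -> : (fun t : R => complex.Im (cexp (z * t%:C%C))) =
    (fun t => expR (complex.Re z * t) * sin (complex.Im z * t)).
  by apply/funext => t; rewrite cexp_lin.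
move=> t; exact: (continuousM (continuous_expM (complex.Re z) t)
  (continuous_sinM (complex.Im z) t)).
Qed.

Lemma cmeas_cexp (D : set (measurableTypeR R)) (z : R[i]) : measurable D ->
  cmeas D (fun t => cexp (z * t%:C%C)).
Proof.
by move=> mD; apply: cmeas_continuous => //;
  [exact: continuous_Re_cexp|exact: continuous_Im_cexp].
Qed.

Lemma cint_cexp (z : R[i]) (a b : R) : a <= b -> z != 0 ->
  cintg `[a, b[ (fun t => cexp (z * t%:C%C)) /\
  cint `[a, b[ (fun t => cexp (z * t%:C%C)) =
  (cexp (z * b%:C%C) - cexp (z * a%:C%C)) / z.
Proof.
move=> ab z0.
pose u (t : R) := complex.Re (cexp (z * t%:C%C)).
pose v (t : R) := complex.Im (cexp (z * t%:C%C)).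
set p := complex.Re z; set q := complex.Im z.
have du (x : R) : is_derive x (1:R) u (p * u x - q * v x).
  have -> : u = fun t => expR (p * t) * cos (q * t).
    by apply/funext => t; rewrite /u cexp_lin.
  rewrite /v cexp_lin /= -/p -/q.
  apply: is_derive_eq; rewrite /GRing.scale /=.
  by ring.
have dv (x : R) : is_derive x (1:R) v (p * v x + q * u x).
  have -> : v = fun t => expR (p * t) * sin (q * t).
    by apply/funext => t; rewrite /v cexp_lin.
  rewrite /u cexp_lin /= -/p -/q.
  apply: is_derive_eq; rewrite /GRing.scale /=.
  by ring.
have cu : continuous u by exact: continuous_Re_cexp.
have cv : continuous v by exact: continuous_Im_cexp.
pose m := p ^+ 2 + q ^+ 2.
have m0 : m != 0 by have := cabs2_eq0 _ z; rewrite (negbTE z0) => /negbT.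
(* The antiderivatives are the real and imaginary parts of exp(z t) / z, since 1/z = (p - i q) /
   m. *)
have dU (x : R) : is_derive x (1:R) (fun t => m^-1 * (p * u t + q * v t)) (u x).
  have := du x; have := dv x => dvx dux.
  apply: is_derive_eq; rewrite /GRing.scale /=.
  rewrite /m in m0 *; by field.
have dV (x : R) : is_derive x (1:R) (fun t => m^-1 * (p * v t - q * u t)) (v x).
  have := du x; have := dv x => dvx dux.
  apply: is_derive_eq; rewrite /GRing.scale /=.
  rewrite /m in m0 *; by field.
have [iu Iu] := Rintegral_FTC _ _ a b ab dU cu.
have [iv Iv] := Rintegral_FTC _ _ a b ab dV cv.
split; first by split.
have zV : z^-1 = Complex (p / m) (- (q / m)).
  by case: (z) @p @q @m {m0 du dv cu cv dU dV iu Iu iv Iv u v}.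
transitivity (Complex (Rintegral mu `[a, b[ u) (Rintegral mu `[a, b[ v)) => //.
rewrite Iu Iv zV /u /v.
have ReV : complex.Re (Complex (p / m) (- (q / m))) = p / m by [].
have ImV : complex.Im (Complex (p / m) (- (q / m))) = - (q / m) by [].
apply: complex_ext; rewrite ?cReM ?cImM ?cReD ?cImD ?cReN ?cImN ReV ImV.
  by rewrite /=; field.
by rewrite /=; field.
Qed.

End Exponentials.

(** * Fourier coefficients and the Bessel inequality *)

Section Characters.
Variable R : realType.
Local Notation mu := (@lebesgue_measure R).

(** One family with three uses: frequency step [beta] on a period 1/[beta] in time, and steps
    [alpha] and 1/[beta] on periods 1/[alpha] and [beta] in the dual variable. *)
Definition echar (b : R) (n : int) (t : R) : R[i] := cexpi (2 * pi * b * n%:~R * t).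

Lemma echarD b m n t : echar b (m + n) t = echar b m t * echar b n t.
Proof. by rewrite /echar -cexpiD -mulrDl -mulrDr rmorphD. Qed.

Lemma echar0 b t : echar b 0 t = 1.
Proof. by rewrite /echar mulr0 mul0r cexpi0. Qed.

Lemma echarN b n t : echar b (- n) t = conjc (echar b n t).
Proof. by rewrite /echar -cexpiN rmorphN mulrN mulNr. Qed.

Lemma cabs2_echar b n t : cabs2 (echar b n t) = 1.
Proof. exact: cabs2_cexpi. Qed.

Lemma echarX b (n : nat) t : echar b n t = echar b 1 t ^+ n.
Proof.
elim: n => [|n IH]; first by rewrite echar0.
by rewrite -addn1 PoszD echarD IH -exprSr addn1.
Qed.

Lemma echarE b n t : echar b n t = cexp ((ci R * (2 * pi * b * n%:~R)%:C%C) * t%:C%C).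
Proof. by rewrite /echar cexpiE [in LHS]rmorphM mulrA. Qed.

Lemma echar_shift b T n t (j : int) : b * T = 1 ->
  echar b n (t + j%:~R * T) = echar b n t.
Proof.
move=> bT; rewrite /echar mulrDr cexpiD.
have -> : 2 * pi * b * n%:~R * (j%:~R * T) = 2 * pi * (n * j)%:~R.
  rewrite rmorphM /=; transitivity (2 * pi * (n%:~R * j%:~R) * (b * T)); first by ring.
  by rewrite bT mulr1.
by rewrite cexpi_int mulr1.
Qed.

Lemma cmeas_echar (D : set (measurableTypeR R)) b n : measurable D ->
  cmeas D (echar b n).
Proof.
move=> mD; have := cmeas_cexp _ D (ci R * (2 * pi * b * n%:~R)%:C%C) mD.
by apply: eq_cmeas => t _; rewrite echarE.
Qed.

Lemma mu_itvco_fin (a c : R) : (mu `[a, c[ < +oo)%E.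
Proof. by rewrite lebesgue_measure_itv /=; case: ifP => _; rewrite ?ltry. Qed.

Lemma measurable_itvT (i : interval R) :
  measurable ([set` i] : set (measurableTypeR R)).
Proof. exact: measurable_itv. Qed.

Hint Resolve measurable_itvT : core.

Lemma cL2_echar (a c b : R) n : cL2 `[a, c[ (echar b n).
Proof.
apply: (cL2_bnd _ _ _ 1) => //; first exact: mu_itvco_fin.
  exact: cmeas_echar.
by move=> t _; rewrite cabs2_echar.
Qed.

Lemma cint_cst (a c : R) (z : R[i]) : a <= c ->
  cintg `[a, c[ (fun=> z) /\ cint `[a, c[ (fun=> z) = z * (c - a)%:C%C.
Proof.
move=> ac; have muac : fine (mu `[a, c[) = c - a.
  rewrite lebesgue_measure_itv /= lte_fin; case: ltP => [//|ca].
  by apply/esym/eqP; rewrite subr_eq0 eq_le ac ca.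
split.
  by split; apply: (@measurable_bounded_integrable _ _ _ mu) => //;
    [exact: mu_itvco_fin|exact: bounded_cst|exact: mu_itvco_fin|exact: bounded_cst].
apply: complex_ext; rewrite ?cReM ?cImM /= !Rintegral_cst// muac !mulr0.
  by rewrite subr0.
by rewrite add0r.
Qed.

Section Period.
Variables (b T x0 : R).
Hypotheses (T0 : 0 < T) (bT : b * T = 1).
Local Notation D := (`[x0, x0 + T[%classic : set (measurableTypeR R)).

Let b0 : 0 < b.
Proof. by rewrite -(pmulr_lgt0 _ T0) bT. Qed.

Lemma cint_echar n : cint D (echar b n) = if n == 0 then T%:C%C else 0.
Proof.
have leT : x0 <= x0 + T by rewrite lerDl ltW.
case: eqP => [->|/eqP n0].
  have [_ <-] : cintg D (fun=> 1) /\ cint D (fun=> 1) = T%:C%C.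
    by have [? ->] := cint_cst x0 (x0 + T) 1 leT; split=> //; rewrite mul1r addrC addKr.
  by apply: eq_cint => t _; rewrite echar0.
set z := ci R * (2 * pi * b * n%:~R)%:C%C.
have z0 : z != 0.
  rewrite mulf_neq0//; first by rewrite eq_complex /= oner_eq0 andbF.
  rewrite -cabs2_eq0 cabs2_real sqrf_eq0 !mulf_neq0// ?intr_eq0//.
    by rewrite gt_eqF// pi_gt0.
  by rewrite gt_eqF.
have [_ e] := cint_cexp _ z x0 (x0 + T) leT z0.
transitivity (cint D (fun t => cexp (z * t%:C%C))).
  by apply: eq_cint => t _; rewrite echarE.
rewrite e -!echarE.
have := echar_shift b T n x0 1 bT; rewrite mul1r => ->.
by rewrite subrr mul0r.
Qed.

Lemma echar_ortho m n : cint D (fun t => echar b m t * conjc (echar b n t)) =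
  if m == n then T%:C%C else 0.
Proof.
rewrite -[m == n]subr_eq0 -cint_echar; apply: eq_cint => t _.
by rewrite echarD echarN.
Qed.

(** Not normalised by the length of the period, so Parseval takes the form sum |fcoef|^2 = T nsq. *)
Definition fcoef (F : R -> R[i]) (n : int) : R[i] :=
  cint D (fun t => F t * conjc (echar b n t)).

Lemma cL2_expsum k (m : 'I_k -> int) (a : 'I_k -> R[i]) :
  cL2 D (fun t => \sum_i a i * echar b (m i) t).
Proof. by apply: cL2_sum => // i; apply: cL2Z => //; exact: cL2_echar. Qed.

Lemma cint_expsum F k (m : 'I_k -> int) (a : 'I_k -> R[i]) : cL2 D F ->
  cint D (fun t => F t * conjc (\sum_i a i * echar b (m i) t)) =
  \sum_i conjc (a i) * fcoef F (m i).
Proof.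
move=> lF; have iF i : cintg D (fun t => F t * conjc (echar b (m i) t)).
  by apply: cL2_cintg => //; exact: cL2_echar.
transitivity (cint D (fun t =>
    \sum_i conjc (a i) * (F t * conjc (echar b (m i) t)))).
  apply: eq_cint => t _; rewrite conjc_sum mulr_sumr; apply: eq_bigr => i _.
  by rewrite conjcM; ring.
rewrite cint_sum//; last by move=> i; exact: cintgZ.
by apply: eq_bigr => i _; rewrite cintZ.
Qed.

Lemma nsq_expsum k (m : 'I_k -> int) (a : 'I_k -> R[i]) : injective m ->
  nsq D (fun t => \sum_i a i * echar b (m i) t) = T * \sum_i cabs2 (a i).
Proof.
move=> inj_m; apply: complexI; rewrite -cint_nsq cint_expsum; last exact: cL2_expsum.
rewrite rmorphM rmorph_sum /= mulr_sumr; apply: eq_bigr => i _.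
suff -> : fcoef (fun t => \sum_i a i * echar b (m i) t) (m i) = a i * T%:C%C.
  by rewrite cabs2E; ring.
rewrite /fcoef.
transitivity (cint D (fun t =>
    \sum_j a j * (echar b (m j) t * conjc (echar b (m i) t)))).
  by apply: eq_cint => t _; rewrite mulr_suml; apply: eq_bigr => j _; rewrite mulrA.
have iE j : cintg D (fun t => echar b (m j) t * conjc (echar b (m i) t)).
  by apply: cL2_cintg => //; exact: cL2_echar.
rewrite cint_sum//; last by move=> j; exact: cintgZ.
rewrite (bigD1 i)//= cintZ// echar_ortho eqxx big1 ?addr0// => j ji.
by rewrite cintZ// echar_ortho (inj_eq inj_m) (negbTE ji) mulr0.
Qed.

Lemma nsqD F G : cL2 D F -> cL2 D G -> nsq D (fun t => F t + G t) =
  nsq D F + nsq D G + 2 * complex.Re (cint D (fun t => F t * conjc (G t))).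
Proof.
move=> lF lG; apply: complexI; rewrite -cint_nsq.
have iFF := cL2_cintg _ D F F (measurable_itvT _) lF lF.
have iFG := cL2_cintg _ D F G (measurable_itvT _) lF lG.
have iGF := cL2_cintg _ D G F (measurable_itvT _) lG lF.
have iGG := cL2_cintg _ D G G (measurable_itvT _) lG lG.
transitivity (cint D (fun t => (F t * conjc (F t) + G t * conjc (G t)) +
    (F t * conjc (G t) + G t * conjc (F t)))).
  by apply: eq_cint => t _; rewrite conjcD; ring.
rewrite cintD//; [|exact: cintgD..].
rewrite !cintD// !cint_nsq.
have -> : cint D (fun t => G t * conjc (F t)) = conjc (cint D (fun t => F t * conjc (G t))).
  by rewrite -cintJ//; apply: eq_cint => t _; rewrite conjcM conjcK mulrC.
rewrite !rmorphD rmorphM /= addcJ; congr (_ + _ * _).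
by apply: complex_ext; rewrite /= ?addr0.
Qed.

Lemma bessel_ord F k (m : 'I_k -> int) : cL2 D F -> injective m ->
  \sum_i cabs2 (fcoef F (m i)) <= T * nsq D F.
Proof.
move=> lF inj_m; set X := \sum_i _.
(* G is minus the orthogonal projection of F on the chosen characters (b = 1/T), so nsq (F + G) =
   nsq F - b X, and this is nonnegative. *)
pose a i := - (b%:C%C * fcoef F (m i)).
pose G t := \sum_i a i * echar b (m i) t.
have lG : cL2 D G by exact: cL2_expsum.
have := nsq_ge0 _ D (fun t => F t + G t).
rewrite nsqD// nsq_expsum// cint_expsum//.
have -> : \sum_i cabs2 (a i) = b ^+ 2 * X.
  rewrite /X mulr_sumr; apply: eq_bigr => i _.
  by rewrite cabs2N cabs2M cabs2_real.
have -> : \sum_i conjc (a i) * fcoef F (m i) = (- (b * X))%:C%C.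
  have -> : (- (b * X))%:C%C = - (b%:C%C * X%:C%C) :> R[i] by rewrite rmorphN rmorphM.
  have -> : X%:C%C = \sum_i fcoef F (m i) * conjc (fcoef F (m i)).
    by rewrite rmorph_sum; apply: eq_bigr => i _; exact: cabs2E.
  rewrite mulr_sumr -sumrN; apply: eq_bigr => i _.
  rewrite /a (_ : conjc (- _) = - conjc (b%:C%C * fcoef F (m i))); last exact: (rmorphN conjc).
  by rewrite conjcM conjc_real; ring.
rewrite /= => h.
have TbX : T * (b * X) = X by rewrite mulrA (mulrC T) bT mul1r.
have : 0 <= T * (nsq D F + T * (b ^+ 2 * X) + 2 * - (b * X)) by rewrite mulr_ge0// ltW.
have -> : T * (nsq D F + T * (b ^+ 2 * X) + 2 * - (b * X)) =
  T * nsq D F + (b * T) * (T * (b * X)) - 2 * (T * (b * X)) by ring.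
by rewrite TbX bT; lra.
Qed.

Lemma bessel F (J : seq int) : cL2 D F -> uniq J ->
  \sum_(n <- J) cabs2 (fcoef F n) <= T * nsq D F.
Proof.
move=> lF uJ; rewrite (big_nth 0) big_mkord.
apply: (bessel_ord F _ (fun i : 'I_(size J) => nth 0 J i) lF) => i j /eqP.
by rewrite nth_uniq// => /eqP /val_inj.
Qed.

End Period.
End Characters.
Arguments echar {R} b n t.
Arguments fcoef {R} b T x0 F n.

(** * Completeness of the trigonometric system *)

Section ScalarApproximation.
Variable R : realType.

Lemma bernoulli_ge (y : R) n : 0 <= y <= 1 -> 1 - n%:R * y <= (1 - y) ^+ n.
Proof.
move=> /andP[y0 y1]; elim: n => [|n IH]; first by rewrite mul0r subr0 expr0.
rewrite exprSr; apply: (@le_trans _ _ ((1 - n%:R * y) * (1 - y))).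
  rewrite -[n.+1%:R]natr1 -subr_ge0.
  have -> : (1 - n%:R * y) * (1 - y) - (1 - (n%:R + 1) * y) = n%:R * (y * y) by ring.
  by rewrite mulr_ge0// mulr_ge0.
by rewrite ler_wpM2r// subr_ge0.
Qed.

(** Here n y <= (1 + y)^n, and (1 - y)(1 + y) <= 1. *)
Lemma bernoulli_le (y : R) n : 0 <= y <= 1 -> (1 - y) ^+ n * (n%:R * y) <= 1.
Proof.
move=> /andP[y0 y1].
have h : n%:R * y <= (1 + y) ^+ n.
  elim: n => [|n IH]; first by rewrite mul0r.
  have p1 : 1 <= (1 + y) ^+ n by rewrite exprn_ege1// lerDl.
  rewrite exprSr mulrDr mulr1 -[n.+1%:R]natr1 mulrDl mul1r lerD//.
  by rewrite ler_peMl.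
apply: (@le_trans _ _ ((1 - y) ^+ n * (1 + y) ^+ n)).
  by rewrite ler_wpM2l// exprn_ge0// subr_ge0.
rewrite -exprMn exprn_ile1//.
  by rewrite mulr_ge0// ?subr_ge0// addr_ge0.
have -> : (1 - y) * (1 + y) = 1 - y ^+ 2 by ring.
by rewrite lerBlDr lerDl sqr_ge0.
Qed.

(** Since 2^(k+1) x^(k+1) = (2 x)^(k+1), the transition happens at x = 1/2. Being polynomial in x,
    it maps trigonometric polynomials to trigonometric polynomials. *)
Definition step_pow (k : nat) (x : R) : R := (1 - x ^+ k.+1) ^+ (2 ^ k.+1).

Lemma step_pow_bnd k x : 0 <= x <= 1 -> 0 <= step_pow k x <= 1.
Proof.
move=> /andP[x0 x1]; have xk : 0 <= 1 - x ^+ k.+1 by rewrite subr_ge0 exprn_ile1.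
by rewrite exprn_ge0//= exprn_ile1// lerBlDr lerDl exprn_ge0.
Qed.

(* Brosowski-Deutsch: (1 - x^k)^(2^k) is squeezed by 1 - (2x)^k from below and
   by (2x)^(-k) from above. *)
Lemma cvg_step_pow x : 0 <= x <= 1 -> x != 2^-1 ->
  step_pow k x @[k --> \oo] --> ((x < 2^-1)%R%:R : R).
Proof.
move=> /andP[x0 x1] x2.
have xk k : 0 <= x ^+ k.+1 <= 1 by rewrite exprn_ge0//= exprn_ile1.
have pow k : (2 ^ k.+1)%:R * x ^+ k.+1 = (2 * x) ^+ k.+1 by rewrite natrX exprMn.
have shift z : `|z| < 1 -> z ^+ k.+1 @[k --> \oo] --> (0 : R).
  move=> z1; have := cvg_expr z1; rewrite -(cvg_shiftS (GRing.exp z)); exact.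
have sb k : 0 <= step_pow k x <= 1 by apply: step_pow_bnd; rewrite x0 x1.
case: ltP => xlt.
  apply: (@squeeze_cvgr _ _ _ _ (fun k => 1 - (2 * x) ^+ k.+1) (fun=> 1)).
  - apply: nearW => k; have /andP[_ ->] := sb k.
    by rewrite -pow andbT /step_pow bernoulli_ge.
  - rewrite -[X in _ --> X]subr0; apply: cvgB; first exact: cvg_cst.
    by apply: shift; rewrite ger0_norm ?mulr_ge0//; lra.
  - exact: cvg_cst.
have {}xlt : 2^-1 < x by rewrite lt_neqAle eq_sym x2.
have h : 0 < 2 * x by rewrite mulr_gt0// (lt_trans _ xlt) ?invr_gt0.
apply: (@squeeze_cvgr _ _ _ _ (fun=> 0) (fun k => (2 * x)^-1 ^+ k.+1)).
- apply: nearW => k; have /andP[-> _] := sb k.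
  rewrite exprVn -[leRHS]mul1r ler_pdivlMr ?exprn_gt0//.
  by rewrite -pow /step_pow bernoulli_le.
- exact: cvg_cst.
- apply: shift; rewrite ger0_norm ?invr_ge0 ?(ltW h)// invf_lt1//; lra.
Qed.

End ScalarApproximation.

(** * The algebra of trigonometric polynomials *)

Section TrigonometricPolynomials.
Variables (R : realType) (b : R).

(** Laurent polynomials in [echar b 1], written as a negative power times an ordinary polynomial:
    products reduce to polynomial multiplication, and [istrigE] reads off coefficients with distinct
    frequencies. *)
Definition istrig (h : R -> R[i]) := exists M : nat, exists p : {poly R[i]},
  forall t, h t = echar b (- M%:Z) t * p.[echar b 1 t].

Lemma istrig_cst z : istrig (fun=> z).
Proof. by exists 0, z%:P => t; rewrite hornerC echar0 mul1r. Qed.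

Lemma echar_raise (M N : nat) t :
  echar b (- M%:Z) t = echar b (- (M + N)%N%:Z) t * echar b 1 t ^+ N.
Proof. by rewrite -echarX -echarD PoszD opprD addrNK. Qed.

Lemma istrigD f g : istrig f -> istrig g -> istrig (fun t => f t + g t).
Proof.
move=> [M [p fE]] [N [q gE]]; exists (M + N)%N, (p * 'X^N + q * 'X^M) => t.
rewrite fE gE (echar_raise M N) (echar_raise N M) (addnC N M) !hornerE.
by ring.
Qed.

Lemma istrigM f g : istrig f -> istrig g -> istrig (fun t => f t * g t).
Proof.
move=> [M [p fE]] [N [q gE]]; exists (M + N)%N, (p * q) => t.
by rewrite fE gE PoszD opprD echarD hornerM; ring.
Qed.

Lemma istrigX f n : istrig f -> istrig (fun t => f t ^+ n).
Proof.
move=> tf; elim: n => [|n IH]; first exact: istrig_cst.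
by under eq_fun do rewrite exprS; exact: istrigM.
Qed.

Lemma eq_istrig f g : f =1 g -> istrig f -> istrig g.
Proof. by move=> fg; rewrite (_ : f = g)//; exact/funext. Qed.

Lemma istrig_sum (I : Type) (r : seq I) (F : I -> R -> R[i]) :
  (forall i, istrig (F i)) -> istrig (fun t => \sum_(i <- r) F i t).
Proof.
move=> tF; elim: r => [|i r IH].
  by apply: eq_istrig (istrig_cst 0) => t; rewrite big_nil.
by apply: eq_istrig (istrigD _ _ (tF i) IH) => t; rewrite big_cons.
Qed.

Lemma istrig_cos (m : R) : istrig (fun t => (cos (2 * pi * b * (t - m)))%:C%C).
Proof.
pose k := cexpi (- (2 * pi * b * m)).
exists 1, ((2^-1 * k)%:P * 'X^2 + (2^-1 * conjc k)%:P) => t.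
rewrite hornerD hornerCM hornerXn hornerC -echarX [RHS]mulrDr.
have e1 : echar b (- 1%:Z) t * echar b 2%:Z t = echar b 1 t by rewrite -echarD.
have e2 : echar b (- 1%:Z) t = conjc (echar b 1 t) by rewrite echarN.
transitivity (2^-1 * (k * (echar b (- 1%:Z) t * echar b 2%:Z t)) +
  2^-1 * (conjc k * echar b (- 1%:Z) t)); last by ring.
rewrite e1 e2 -conjcM.
have -> : k * echar b 1 t = cexpi (2 * pi * b * (t - m)).
  by rewrite /k /echar -cexpiD; congr cexpi; ring.
set A := cexpi _.
have -> : 2^-1 * A + 2^-1 * conjc A = 2^-1 * (A + conjc A) by rewrite mulrDr.
by rewrite addcJ mulrA mulVf ?pnatr_eq0// mul1r.
Qed.

Lemma istrigE h : istrig h -> exists k (m : 'I_k -> int) (a : 'I_k -> R[i]),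
  injective m /\ h = fun t => \sum_i a i * echar b (m i) t.
Proof.
move=> [M [p hE]]; exists (size p), (fun i => i%:Z - M%:Z), (fun i => p`_i); split.
  by move=> i j /addIr [] /val_inj.
apply/funext => t; rewrite hE horner_coef mulr_sumr; apply: eq_bigr => i _.
by rewrite -echarX mulrCA -echarD addrC.
Qed.

End TrigonometricPolynomials.

(** * Indicators of arcs as bounded limits of trigonometric polynomials *)

Section ArcIndicator.
Variable R : realType.
Variables (b T x0 : R).
Hypotheses (T0 : 0 < T) (bT : b * T = 1).

Let b0 : 0 < b.
Proof. by rewrite -(pmulr_lgt0 _ T0) bT. Qed.

(** On a circle of length T, the arc from a to c is the cap around its midpoint m on which the
    cosine exceeds its value at the ends, and the cosine decreases on [0, pi]. *)
Lemma cos_lt_arc (a c t : R) : x0 <= a -> a < c -> c <= x0 + T -> c - a < T ->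
  x0 < t < x0 + T -> t != a -> t != c ->
  let m := (a + c) / 2 in let th := pi * b * (c - a) in
  ((cos th < cos (2 * pi * b * (t - m))) = (a < t < c)) /\
  cos (2 * pi * b * (t - m)) != cos th.
Proof.
move=> x0a ac cx0 caT /andP[x0t tx0] ta tc m th.
have pib : 0 < pi * b :> R by rewrite mulr_gt0 ?pi_gt0.
have pibT : pi * b * T = pi by rewrite -mulrA bT mulr1.
have th0 : 0 < th by rewrite mulr_gt0// subr_gt0.
have thpi : th < pi by rewrite -[ltRHS]pibT ltr_pM2l.
set x := 2 * pi * b * (t - m).
have xE : `|x| = pi * b * (2 * `|t - m|).
  by rewrite /x normrM ger0_norm; [ring|rewrite -mulrA mulr_ge0// ltW].
have -> : cos x = cos `|x| by case: (ler0P x) => // _; rewrite cosN.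
have thI : th \in `[0, pi] by rewrite in_itv /= (ltW th0) (ltW thpi).
have [/andP[at_ tc']|nin] := boolP (a < t < c).
  have xth : `|x| < th.
    rewrite xE ltr_pM2l//.
    have : `|t - m| < (c - a) / 2 by rewrite ltr_norml /m; apply/andP; split; lra.
    by lra.
  have xI : `|x| \in `[0, pi] by rewrite in_itv /= normr_ge0 (ltW (lt_trans xth thpi)).
  have lt : cos th < cos `|x| by rewrite ltr_cos.
  by split; rewrite ?lt// gt_eqF.
have xth : th < `|x|.
  rewrite xE ltr_pM2l//.
  have : (c - a) / 2 < `|t - m|.
    rewrite lter_normr /m; move: nin; rewrite negb_and -!leNgt => /orP[h|h].
      have {}h : t < a by rewrite lt_neqAle ta.
      by apply/orP; right; lra.
    have {}h : c < t by rewrite lt_neqAle eq_sym tc.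
    by apply/orP; left; lra.
  by lra.
(* As m need not be the centre of the period, |x| can exceed pi. It stays below 2 pi - th, so its
   reflection 2 pi - |x| still lies beyond th. *)
have xth2 : `|x| < 2 * pi - th.
  have -> : 2 * pi - th = pi * b * (2 * T - (c - a)).
    transitivity (2 * (pi * b * T) - th); [by rewrite pibT|by rewrite /th; ring].
  rewrite xE ltr_pM2l//.
  have : `|t - m| < T - (c - a) / 2 by rewrite ltr_norml /m; apply/andP; split; lra.
  by lra.
have lt : cos `|x| < cos th.
  have [xpi|xpi] := leP `|x| pi.
    have xI : `|x| \in `[0, pi] by rewrite in_itv /= normr_ge0.
    by rewrite ltr_cos.
  have -> : cos `|x| = cos (pi *+ 2 - `|x|).
    by rewrite addrC cosD2pi cosN.
  rewrite -mulr_natl.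
  have xI : 2 * pi - `|x| \in `[0, pi].
    by rewrite in_itv /=; apply/andP; split; lra.
  by rewrite ltr_cos//; lra.
by split; [apply/negbTE; rewrite -leNgt ltW|rewrite lt_eqF].
Qed.

Lemma arc_indicator (a c : R) : x0 <= a -> a < c -> c <= x0 + T -> c - a < T ->
  exists v : nat -> R -> R,
  [/\ forall k, istrig R b (fun t => (v k t)%:C%C),
      forall k t, 0 <= v k t <= 1 &
      forall t, x0 < t < x0 + T -> t != a -> t != c ->
        v k t @[k --> \oo] --> ((a < t < c)%R%:R : R)].
Proof.
move=> x0a ac cx0 caT; pose m := (a + c) / 2; pose th := pi * b * (c - a).
(* An affine image of the cosine with values in [0, 1] which, away from the endpoints, is below 1/2
   exactly inside the arc. *)
pose u t := 2^-1 + (cos th - cos (2 * pi * b * (t - m))) / 4.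
have u01 t : 0 <= u t <= 1.
  have := cos_le1 th; have := cos_geN1 th.
  have := cos_le1 (2 * pi * b * (t - m)); have := cos_geN1 (2 * pi * b * (t - m)).
  by rewrite /u => *; apply/andP; split; lra.
exists (fun k t => step_pow R k (u t)); split.
- move=> k.
  have tu : istrig R b (fun t => (u t)%:C%C).
    have t1 := istrig_cos R b m.
    have t2 := istrigM _ _ _ _ (istrig_cst R b (- (4^-1)%:C%C)) t1.
    have t3 := istrigD _ _ _ _ (istrig_cst R b (2^-1 + cos th / 4)%:C%C) t2.
    apply: eq_istrig t3 => t; rewrite -rmorphN -rmorphM -rmorphD.
    by congr (_%:C%C); rewrite /u; ring.
  have t4 := istrigM _ _ _ _ (istrig_cst R b (-1)) (istrigX _ _ _ k.+1 tu).
  have t5 := istrigX _ _ _ (2 ^ k.+1) (istrigD _ _ _ _ (istrig_cst R b 1) t4).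
  apply: eq_istrig t5 => t.
  by rewrite /step_pow rmorphXn rmorphB rmorphXn rmorph1 mulN1r.
- by move=> k t; exact: step_pow_bnd.
- move=> t tI ta tc.
  have [e ne] := cos_lt_arc a c t x0a ac cx0 caT tI ta tc.
  have -> : (a < t < c) = (u t < 2^-1).
    rewrite -e /u -/m -/th; apply/idP/idP; lra.
  apply: cvg_step_pow => //; apply: contra ne => /eqP ut.
  by apply/eqP; move: ut; rewrite /u -/m -/th; lra.
Qed.

End ArcIndicator.

Section Dominated.
Variable R : realType.
Local Notation mu := (@lebesgue_measure R).

Lemma Rintegral_dominated (D : set (measurableTypeR R)) (f_ : nat -> R -> R)
    (f g : R -> R) : measurable D ->
  (forall k, measurable_fun D (f_ k)) -> measurable_fun D f ->
  {ae mu, forall t, D t -> f_ k t @[k --> \oo] --> f t} ->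
  mu.-integrable D (EFin \o g) ->
  (forall k t, D t -> `|f_ k t| <= g t) ->
  mu.-integrable D (EFin \o f) /\
  Rintegral mu D (f_ k) @[k --> \oo] --> Rintegral mu D f.
Proof.
move=> mD mf_ mf cf ig fg.
have [|||||iF _ c] := @dominated_convergence _ _ R mu D mD
  (fun k => EFin \o f_ k) (EFin \o f) (EFin \o g).
- by move=> k; exact/measurable_EFinP.
- exact/measurable_EFinP.
- apply: filterS cf => t + Dt => /(_ Dt) ct.
  by apply: cvg_EFin => //; exact: nearW.
- exact: ig.
- by apply: aeW => t k Dt /=; rewrite lee_fin fg.
- split=> //; apply: fine_cvg.
  by rewrite fineK//; exact: integrable_fin_num.
Qed.

End Dominated.

(** * Duality: bounded coefficient sums bound the pairing with F *)

Section Star.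
Variable R : realType.
Local Notation mu := (@lebesgue_measure R).
Variables (b T x0 : R).
Hypotheses (T0 : 0 < T) (bT : b * T = 1).
Local Notation D := (`[x0, x0 + T[%classic : set (measurableTypeR R)).
Variables (F : R -> R[i]) (S : R).
Hypotheses (lF : cL2 D F)
  (FS : forall J : seq int, uniq J -> \sum_(n <- J) cabs2 (fcoef b T x0 F n) <= S).

Let mD : measurable D. Proof. exact: measurable_itvT. Qed.

Lemma fcoef_bound_ge0 : 0 <= S.
Proof. by have := FS [::] isT; rewrite big_nil. Qed.

(* [pairing_bounded h] says that the functional <F, .> has norm at most sqrt (S / T) at h. *)
Definition pairing_bounded (h : R -> R[i]) :=
  cabs2 (cint D (fun t => F t * conjc (h t))) <= S * b * nsq D h.

(** If h has coefficients a, Cauchy-Schwarz bounds the pairing by S sum |a_i|^2, and orthogonality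
    makes this sum equal to b nsq h. *)
Lemma pairing_bounded_trig h : istrig R b h -> pairing_bounded h.
Proof.
move=> /istrigE [k [m [a [inj_m ->]]]].
rewrite /pairing_bounded cint_expsum// nsq_expsum//.
rewrite (le_trans (cabs2_sum_mul _ _ _ _ _))//.
under eq_bigr do rewrite cabs2J.
rewrite -mulrA [b * _]mulrA bT mul1r mulrC ler_wpM2r//.
  by apply: sumr_ge0 => i _; exact: cabs2_ge0.
have := FS [seq m i | i <- enum 'I_k].
by rewrite map_inj_uniq// enum_uniq big_map big_enum /= => /(_ isT).
Qed.

Lemma cmeas_trig h : istrig R b h -> cmeas D h.
Proof.
move=> /istrigE [k [m [a [_ ->]]]]; apply: cmeas_sum => i.
by apply: cmeasM; [exact: cmeas_cst|exact: cmeas_echar].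
Qed.

(** Both sides pass to the limit by dominated convergence: F conj(p k) is dominated by |F|^2 + K and
    |p k|^2 by K, which is integrable on a bounded period. *)
Lemma pairing_bounded_lim (p : nat -> R -> R[i]) h K :
  (forall k, istrig R b (p k)) -> cmeas D h ->
  (forall k t, D t -> cabs2 (p k t) <= K) ->
  {ae mu, forall t, D t ->
    complex.Re (p k t) @[k --> \oo] --> complex.Re (h t) /\
    complex.Im (p k t) @[k --> \oo] --> complex.Im (h t)} ->
  pairing_bounded h.
Proof.
move=> tp mh pK cp.
have mp k := cmeas_trig _ (tp k).
have iK : mu.-integrable D (EFin \o (fun=> K)).
  by apply: measurable_bounded_integrable => //; [exact: mu_itvco_fin|exact: bounded_cst].
have iG : mu.-integrable D (EFin \o (fun t => cabs2 (F t) + K)).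
  exact: (integrableD mD (cL2_integrable _ D F mD lF) iK).
have mF := cL2_meas _ _ _ lF.
have mFp k : cmeas D (fun t => F t * conjc (p k t)).
  by apply: cmeasM => //; exact: cmeasJ.
have mFh : cmeas D (fun t => F t * conjc (h t)).
  by apply: cmeasM => //; exact: cmeasJ.
have cRI (u v : nat -> R) (lu lv r1 r2 : R) : u k @[k --> \oo] --> lu ->
    v k @[k --> \oo] --> lv -> r1 * u k + r2 * v k @[k --> \oo] --> r1 * lu + r2 * lv.
  by move=> cu cv; apply: cvgD; [apply: cvgM cu|apply: cvgM cv]; exact: cvg_cst.
have c1 : Rintegral mu D (fun t => complex.Re (F t * conjc (p k t))) @[k --> \oo] -->
    Rintegral mu D (fun t => complex.Re (F t * conjc (h t))).
  have [] // := Rintegral_dominated _ D (fun k t => complex.Re (F t * conjc (p k t)))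
    (fun t => complex.Re (F t * conjc (h t))) _ mD (fun k => (mFp k).1) mFh.1 _ iG _.
    apply: filterS cp => t + Dt => /(_ Dt) [cr ci].
    rewrite cReM cReJ cImJ mulrN opprK.
    under eq_fun do rewrite cReM cReJ cImJ mulrN opprK.
    exact: cRI.
  move=> k t Dt; rewrite (le_trans (norm_Re_mulJ _ _ _))// lerD2l.
  exact: pK.
have c2 : Rintegral mu D (fun t => complex.Im (F t * conjc (p k t))) @[k --> \oo] -->
    Rintegral mu D (fun t => complex.Im (F t * conjc (h t))).
  have [] // := Rintegral_dominated _ D (fun k t => complex.Im (F t * conjc (p k t)))
    (fun t => complex.Im (F t * conjc (h t))) _ mD (fun k => (mFp k).2) mFh.2 _ iG _.
    apply: filterS cp => t + Dt => /(_ Dt) [cr ci].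
    rewrite cImM cReJ cImJ mulrN -mulNr.
    under eq_fun do rewrite cImM cReJ cImJ mulrN -mulNr.
    exact: cRI.
  move=> k t Dt; rewrite (le_trans (norm_Im_mulJ _ _ _))// lerD2l.
  exact: pK.
have c3 : nsq D (p k) @[k --> \oo] --> nsq D h.
  have [] // := Rintegral_dominated _ D (fun k t => cabs2 (p k t))
    (fun t => cabs2 (h t)) _ mD _ (measurable_cabs2 _ _ _ mh) _ iK _.
  - by move=> k; exact: measurable_cabs2.
  - apply: filterS cp => t + Dt => /(_ Dt) [cr ci].
    by rewrite /cabs2; apply: cvgD; rewrite expr2; apply: cvgM.
  - by move=> k t Dt; rewrite ger0_norm ?cabs2_ge0// pK.
have c4 : cabs2 (cint D (fun t => F t * conjc (p k t))) @[k --> \oo] -->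
    cabs2 (cint D (fun t => F t * conjc (h t))).
  by rewrite /cabs2; apply: cvgD; rewrite expr2; apply: cvgM.
have c5 : S * b * nsq D (p k) @[k --> \oo] --> S * b * nsq D h.
  by apply: cvgM c3; exact: cvg_cst.
apply: (ler_cvg_to c4 c5); apply: nearW => k.
exact: pairing_bounded_trig.
Qed.

End Star.

Section Indicators.
Variable R : realType.
Local Notation mu := (@lebesgue_measure R).
Implicit Types (D A : set (measurableTypeR R)) (F : R -> R[i]).

Definition cindic A (t : R) : R[i] := (\1_A t)%:C%C.

Lemma cmeas_indic D A : measurable A -> cmeas D (cindic A).
Proof. by move=> mA; split => /=; [exact: measurable_indic|exact: measurable_cst]. Qed.

Lemma cint_indic D A F : A `<=` D ->
  cint D (fun t => F t * cindic A t) = cint A F.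
Proof.
move=> AD; have -> : A = D `&` A by rewrite setIidr.
rewrite /cint !Rintegral_mkcondr; congr Complex; apply: eq_Rintegral => t Dt.
  rewrite cReM /= mulr0 subr0 indicE /patch in_setI Dt /=.
  by case: (t \in A); rewrite ?mulr1 ?mulr0.
rewrite cImM /= mulr0 add0r indicE /patch in_setI Dt /=.
by case: (t \in A); rewrite ?mulr1 ?mulr0.
Qed.

Lemma cvg_sumR (I : Type) (r : seq I) (f : I -> nat -> R) (l : I -> R) :
  (forall i, f i k @[k --> \oo] --> l i) ->
  \sum_(i <- r) f i k @[k --> \oo] --> \sum_(i <- r) l i.
Proof.
move=> fl; elim: r => [|i r IH].
  by under eq_fun do rewrite big_nil; rewrite big_nil; exact: cvg_cst.
under eq_fun do rewrite big_cons; rewrite big_cons.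
by apply: cvgD => //; exact: fl.
Qed.

End Indicators.

Section StepFunctions.
Variable R : realType.
Local Notation mu := (@lebesgue_measure R).
Variables (b T x0 : R).
Hypotheses (T0 : 0 < T) (bT : b * T = 1).
Local Notation D := (`[x0, x0 + T[%classic : set (measurableTypeR R)).
Variables (F : R -> R[i]) (S : R).
Hypotheses (lF : cL2 D F)
  (FS : forall J : seq int, uniq J -> \sum_(n <- J) cabs2 (fcoef b T x0 F n) <= S).
Variable N : nat.
Hypothesis N2 : (1 < N)%N.

Let b0 : 0 < b.
Proof. by rewrite -(pmulr_lgt0 _ T0) bT. Qed.

Let mD : measurable D. Proof. exact: measurable_itvT. Qed.

Definition mesh : R := T / N%:R.

Let N0 : (0 < N%:R :> R). Proof. by rewrite ltr0n ltnW. Qed.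

Lemma mesh_gt0 : 0 < mesh. Proof. by rewrite divr_gt0. Qed.

Lemma meshN : N%:R * mesh = T. Proof. by rewrite /mesh mulrC divfK// gt_eqF. Qed.

(** The index is real so that both [j%:R] and the integer floor of (t - x0) / [mesh] can be
    inserted. *)
Definition cell (s : R) : set (measurableTypeR R) :=
  `[x0 + s * mesh, x0 + (s + 1) * mesh[%classic.

Lemma cellP s t : cell s t <-> s <= (t - x0) / mesh < s + 1.
Proof.
have d0 := mesh_gt0; rewrite /cell /= in_itv /=.
by rewrite ler_pdivlMr// ltr_pdivrMr// lerBrDl ltrBlDl.
Qed.

Lemma cell_sub (j : 'I_N) : cell j%:R `<=` D.
Proof.
have d0 := mesh_gt0.
have jN : j%:R + 1 <= N%:R :> R by rewrite natr1 ler_nat.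
have h1 : 0 <= j%:R * mesh by rewrite mulr_ge0// ltW.
have h2 : (j%:R + 1) * mesh <= T by rewrite -[leRHS]meshN ler_wpM2r// ltW.
by move=> t; rewrite /cell /= !in_itv /= => /andP[? ?]; apply/andP; split; lra.
Qed.

Lemma cell_inj (i j : 'I_N) t : cell i%:R t -> cell j%:R t -> i = j.
Proof.
move=> /cellP /andP[i1 i2] /cellP /andP[j1 j2]; apply/val_inj/eqP.
rewrite eqn_leq -[(i <= j)%N]ltnS -[(j <= i)%N]ltnS -!(ltr_nat R) -!natr1.
by rewrite (le_lt_trans i1)// (le_lt_trans j1).
Qed.

Definition step_fun (z : 'I_N -> R[i]) (t : R) : R[i] :=
  \sum_j z j * cindic R (cell j%:R) t.

Lemma step_funE z (j : 'I_N) t : cell j%:R t -> step_fun z t = z j.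
Proof.
move=> ct; rewrite /step_fun (bigD1 j)//= big1 => [|i ij].
  by rewrite addr0 /cindic indicE mem_set// mulr1.
rewrite /cindic indicE memNset ?mulr0// => ci.
by move: ij; rewrite (cell_inj _ _ _ ci ct) eqxx.
Qed.

Lemma cmeas_step z : cmeas D (step_fun z).
Proof.
apply: cmeas_sum => j; apply: cmeasM; first exact: cmeas_cst.
by apply: cmeas_indic; exact: measurable_itvT.
Qed.

Lemma cL2_indic (j : 'I_N) : cL2 D (cindic R (cell j%:R)).
Proof.
apply: (cL2_bnd _ _ _ 1) => //; first exact: mu_itvco_fin.
  by apply: cmeas_indic; exact: measurable_itvT.
by move=> t _; rewrite cabs2_real indicE; case: (_ \in _); rewrite ?expr1n ?expr0n.
Qed.

Lemma cL2_step z : cL2 D (step_fun z).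
Proof. by apply: cL2_sum => // j; apply: cL2Z => //; exact: cL2_indic. Qed.

Lemma cint_step G z : cL2 D G -> cint D (fun t => G t * conjc (step_fun z t)) =
  \sum_j conjc (z j) * cint (cell j%:R) G.
Proof.
move=> lG; have ci j t : conjc (cindic R (cell j) t) = cindic R (cell j) t.
  by rewrite /cindic conjc_real.
have iG (j : 'I_N) : cintg D (fun t => G t * cindic R (cell j%:R) t).
  apply: (eq_cintg _ _ _ _ mD _ (cL2_cintg _ D G _ mD lG (cL2_indic j))).
  by move=> t _; rewrite ci.
transitivity (cint D (fun t =>
    \sum_j conjc (z j) * (G t * cindic R (cell j%:R) t))).
  apply: eq_cint => t _; rewrite /step_fun conjc_sum mulr_sumr.
  by apply: eq_bigr => j _; rewrite conjcM ci; ring.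
rewrite cint_sum//; last by move=> j; exact: cintgZ.
by apply: eq_bigr => j _; rewrite cintZ// cint_indic//; exact: cell_sub.
Qed.

Lemma cell_len s : x0 + (s + 1) * mesh - (x0 + s * mesh) = mesh.
Proof. by ring. Qed.

Lemma cint_cell_step z (j : 'I_N) : cint (cell j%:R) (step_fun z) = z j * mesh%:C%C.
Proof.
have le : x0 + j%:R * mesh <= x0 + (j%:R + 1) * mesh.
  by rewrite -subr_ge0 cell_len ltW// mesh_gt0.
have [_ e] := cint_cst _ _ _ (z j) le; rewrite cell_len in e.
by rewrite -e; apply: eq_cint => t; exact: step_funE.
Qed.

Lemma nsq_step z : nsq D (step_fun z) = mesh * \sum_j cabs2 (z j).
Proof.
apply: complexI; rewrite -cint_nsq cint_step; last exact: cL2_step.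
rewrite rmorphM rmorph_sum /= mulr_sumr; apply: eq_bigr => j _.
by rewrite cint_cell_step cabs2E; ring.
Qed.

Lemma pairing_bounded_step z : pairing_bounded R b T x0 F S (step_fun z).
Proof.
have d0 := mesh_gt0.
have arc (j : 'I_N) : exists v : nat -> R -> R,
  [/\ forall k, istrig R b (fun t => (v k t)%:C%C),
      forall k t, 0 <= v k t <= 1 &
      forall t, x0 < t < x0 + T -> t != x0 + j%:R * mesh ->
         t != x0 + (j%:R + 1) * mesh ->
        v k t @[k --> \oo] -->
        ((x0 + j%:R * mesh < t < x0 + (j%:R + 1) * mesh)%R%:R : R)].
  have jN : j%:R + 1 <= N%:R :> R by rewrite natr1 ler_nat.
  have h1 : 0 <= j%:R * mesh by rewrite mulr_ge0// ltW.
  have h2 : (j%:R + 1) * mesh <= T by rewrite -[leRHS]meshN ler_wpM2r// ltW.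
  (* N > 1 enters here: [arc_indicator] needs an arc shorter than the full circle. *)
  have h3 : mesh < T by rewrite -[ltRHS]meshN ltr_pMl// ltr1n.
  apply: arc_indicator => //.
  - by rewrite lerDl.
  - by rewrite -subr_gt0 cell_len.
  - by rewrite lerD2l.
  - by rewrite cell_len.
have [v hv] := choice arc.
pose p k t := \sum_j z j * (v j k t)%:C%C.
(* A bound for |p k t|^2 that is uniform in k and t, by Cauchy-Schwarz and 0 <= v <= 1. *)
pose K := N%:R * \sum_j cabs2 (z j).
(* The grid points form a countable, hence null, set that contains both ends of every cell; off it
   all the arc indicators converge. *)
pose A := [set x0 + (j : nat)%:R * mesh | j in [set: nat]].
have cA : countable A by apply: sub_countable (card_image_le _ _) (countableP _).
apply: (pairing_bounded_lim _ b T x0 T0 bT F S lF FS p (step_fun z) K).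
- move=> k; apply: istrig_sum => j; apply: istrigM; first exact: istrig_cst.
  by have [] := hv j.
- exact: cmeas_step.
- move=> k t _; rewrite (le_trans (cabs2_sum_le _ _ _))// ler_wpM2l//.
  apply: ler_sum => j _; rewrite cabs2M cabs2_real ler_piMr ?cabs2_ge0//.
  by have [_ /(_ k t) /andP[v0 v1] _] := hv j; rewrite exprn_ile1.
- exists A; split.
  + by apply: countable_measurable.
  + exact: countable_lebesgue_measure0.
  + move=> t /= nt; apply: contrapT => At; apply: nt => Dt.
    have tA (j : nat) : t != x0 + j%:R * mesh.
      by apply/eqP => tE; apply: At; exists j.
    have tI : x0 < t < x0 + T.
      move: Dt; rewrite /= in_itv /= => /andP[x0t ->]; rewrite andbT lt_neqAle x0t andbT.
      by have := tA 0; rewrite mul0r addr0 eq_sym.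
    have cv (j : 'I_N) : v j k t @[k --> \oo] --> (\1_(cell j%:R) t : R).
      have [_ _ /(_ t tI (tA j))] := hv j.
      have /[swap]/[apply] : t != x0 + (j%:R + 1) * mesh by rewrite natr1.
      suff -> : (x0 + j%:R * mesh < t < x0 + (j%:R + 1) * mesh) = (t \in cell j%:R) by [].
      rewrite lt_neqAle eq_sym tA /= .
      by apply/idP/idP; rewrite inE /cell /= in_itv.
    split.
      rewrite cRe_sum; under eq_fun do rewrite cRe_sum.
      apply: cvg_sumR => j; rewrite cReM /= mulr0 subr0.
      under eq_fun do rewrite cReM /= mulr0 subr0.
      by apply: cvgM => //; exact: cvg_cst.
    rewrite cIm_sum; under eq_fun do rewrite cIm_sum.
    apply: cvg_sumR => j; rewrite cImM /= mulr0 add0r.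
    under eq_fun do rewrite cImM /= mulr0 add0r.
    by apply: cvgM => //; exact: cvg_cst.
Qed.

Definition cell_avg (j : 'I_N) : R[i] := (mesh^-1)%:C%C * cint (cell j%:R) F.

(* Tested against its own cell averages, F pairs to their squared norm. *)
Lemma nsq_cell_avg : nsq D (step_fun cell_avg) <= S * b.
Proof.
have d0 := mesh_gt0.
have := pairing_bounded_step cell_avg; rewrite /pairing_bounded cint_step//.
set X := nsq D _.
have -> : \sum_j conjc (cell_avg j) * cint (cell j%:R) F = X%:C%C.
  rewrite /X nsq_step rmorphM rmorph_sum mulr_sumr; apply: eq_bigr => j _.
  have -> : cint (cell j%:R) F = mesh%:C%C * cell_avg j.
    by rewrite /cell_avg mulrA -rmorphM divff ?gt_eqF// mul1r.
  transitivity (mesh%:C%C * (cell_avg j * conjc (cell_avg j))); first by ring.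
  by rewrite -cabs2E.
rewrite cabs2_real expr2 => h.
have X0 : 0 <= X by exact: nsq_ge0.
have [X_gt0|X_le0] := ltP 0 X; first by rewrite ler_pM2r in h.
rewrite (le_trans X_le0)// mulr_ge0// ?(ltW b0)//.
exact: (fcoef_bound_ge0 R b T x0 F S FS).
Qed.

End StepFunctions.

(** * Convergence of cell averages and the reverse Bessel inequality *)

Section Completeness.
Variable R : realType.
Local Notation mu := (@lebesgue_measure R).
Variables (b T x0 : R).
Hypotheses (T0 : 0 < T) (bT : b * T = 1).
Local Notation D := (`[x0, x0 + T[%classic : set (measurableTypeR R)).

Let mD : measurable D. Proof. exact: measurable_itvT. Qed.

(** The cell that contains x, in the subdivision into n + 2 cells; the shift by 2 keeps the number
    of cells above 1. *)
Let Ecell (x : R) (n : nat) : set (measurableTypeR R) :=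
  cell R T x0 n.+2 (Num.floor ((x - x0) / mesh R T n.+2))%:~R.

Let d0 n : 0 < mesh R T n.+2.
Proof. exact: mesh_gt0. Qed.

Lemma mu_cell N s : 0 < mesh R T N -> mu (cell R T x0 N s) = (mesh R T N)%:E.
Proof.
move=> dN; rewrite /cell lebesgue_measure_itv /= lte_fin -subr_gt0 cell_len dN.
by rewrite -EFinD cell_len.
Qed.

Lemma nicely_shrinking_cell x : nicely_shrinking x (Ecell x).
Proof.
split; first by move=> n; exact: measurable_itvT.
(* The cell lies in the ball of radius [mesh] around x, whose measure 2 [mesh] is twice that of the
   cell. *)
exists (2, fun n => PosNum (d0 n)); split => //=.
- rewrite /mesh -[X in _ --> X](mulr0 T); apply: cvgM; first exact: cvg_cst.
  by move: (@cvg_harmonic R); rewrite -cvg_shiftS; exact.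
- move=> n y /cellP-/(_ T0 isT) /andP[y1 y2].
  have /andP[x1 x2] := floor_itv ((x - x0) / mesh R T n.+2).
  rewrite rmorphD /= in x2.
  rewrite /ball /= -(ltr_pM2r (x := (mesh R T n.+2)^-1)) ?invr_gt0//.
  rewrite divff ?gt_eqF// -{1}(ger0_norm (ltW (_ : 0 < (mesh R T n.+2)^-1))) ?invr_gt0//.
  rewrite -normrM.
  have -> : (x - y) / mesh R T n.+2 = (x - x0) / mesh R T n.+2 - (y - x0) / mesh R T n.+2.
    by rewrite -mulrBl; congr (_ / _); ring.
  by rewrite ltr_norml; apply/andP; split; lra.
- move=> n; rewrite mu_cell// lebesgue_measure_ball; last exact/ltW.
  by rewrite -EFinM lee_fin mulr_natl.
Qed.

Variable F : R -> R[i].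
Hypothesis lF : cL2 D F.

Let h n := step_fun R T x0 n.+2 (cell_avg R T x0 F n.+2).

(** Lebesgue differentiation is applied to f extended by zero to the line. The cell of a point of D
    stays inside D, so the averages do not see the extension. *)
Lemma cvg_cell_avg (f : R -> R) : mu.-integrable D (EFin \o f) ->
  {ae mu, forall t, D t -> (mesh R T n.+2)^-1 *
    Rintegral mu (cell R T x0 n.+2 (Num.floor ((t - x0) / mesh R T n.+2))%:~R) f
    @[n --> \oo] --> f t}.
Proof.
move=> iF; pose f' := f \_ D.
have iF' : mu.-integrable setT (EFin \o f').
  by have := (@integrable_mkcond _ _ R mu D (EFin \o f) mD).1 iF; rewrite restrict_EFin.
have lf' : locally_integrable setT f' by exact: open_integrable_locally openT iF'.
have [A [mA A0 sA]] := lebesgue_differentiation lf'.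
exists A; split => //; apply: subset_trans sA; apply: subsetC => t /= lt Dt.
have := nice_lebesgue_differentiation nicely_shrinking_cell lf' lt.
have -> : f' t = f t by rewrite /f' patchE mem_set.
move=> /fine_cvg; apply: cvg_trans; apply: near_eq_cvg; apply: nearW => n.
rewrite /= mu_cell// /Ecell.
have Dc : cell R T x0 n.+2 (Num.floor ((t - x0) / mesh R T n.+2))%:~R `<=` D.
  have tI : 0 <= (t - x0) / mesh R T n.+2 < n.+2%:R.
    move: Dt; rewrite /= in_itv /= => /andP[t1 t2].
    apply/andP; split; first by apply: divr_ge0; [rewrite subr_ge0|exact: ltW].
  by rewrite ltr_pdivrMr// meshN// ltrBlDl.
  have : 0 <= Num.floor ((t - x0) / mesh R T n.+2) < n.+2%:Z.
    rewrite floor_ge0; move/andP: tI => [-> tn] /=.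
    by rewrite -(ltr_int R) (le_lt_trans (floor_le _)).
  case: (Num.floor _) => // j /= jn.
  exact: (cell_sub R T x0 T0 n.+2 isT (Ordinal (jn : (j < n.+2)%N))).
have -> : (\int[mu]_(y in cell R T x0 n.+2 (Num.floor ((t - x0) / mesh R T n.+2))%:~R)
    (f' y)%:E = \int[mu]_(y in cell R T x0 n.+2 (Num.floor ((t - x0) / mesh R T n.+2))%:~R)
    (f y)%:E)%E.
  by apply: eq_integral => y /set_mem /Dc Dy; rewrite /f' patchE mem_set.
have iC : mu.-integrable (cell R T x0 n.+2 (Num.floor ((t - x0) / mesh R T n.+2))%:~R)
    (EFin \o f).
  by apply: integrableS iF => //; exact: measurable_itvT.
rewrite -[X in (_ * X)%E](@fineK _ _) ?integrable_fin_num//; last exact: measurable_itvT.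
by rewrite inver gt_eqF.
Qed.

Lemma step_avgE n t : D t -> h n t = ((mesh R T n.+2)^-1)%:C%C *
  cint (cell R T x0 n.+2 (Num.floor ((t - x0) / mesh R T n.+2))%:~R) F.
Proof.
move=> Dt.
have tI : 0 <= (t - x0) / mesh R T n.+2 < n.+2%:R.
  move: Dt; rewrite /= in_itv /= => /andP[t1 t2].
  apply/andP; split; first by apply: divr_ge0; [rewrite subr_ge0|exact: ltW].
  by rewrite ltr_pdivrMr// meshN// ltrBlDl.
have : 0 <= Num.floor ((t - x0) / mesh R T n.+2) < n.+2%:Z.
  rewrite floor_ge0; move/andP: tI => [-> tn] /=.
  by rewrite -(ltr_int R) (le_lt_trans (floor_le _)).
have := floor_itv ((t - x0) / mesh R T n.+2).
case: (Num.floor _) => // j /= jt jn.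
rewrite /h (step_funE R T x0 T0 n.+2 isT _ (Ordinal (jn : (j < n.+2)%N)))//.
by apply/cellP => //=; move: jt; rewrite rmorphD.
Qed.

Lemma cvg_step_avg : {ae mu, forall t, D t -> cabs2 (h n t) @[n --> \oo] --> cabs2 (F t)}.
Proof.
have iF : cintg D F.
  have := cL2_cintg _ D F (fun=> 1) mD lF.
  have /[swap]/[apply] : cL2 D (fun=> 1).
    by apply: (cL2_bnd _ _ _ 1);
      [exact: mD|exact: mu_itvco_fin|exact: cmeas_cst|move=> t _; rewrite cabs21].
  by apply: eq_cintg => // t _; rewrite conjc1 mulr1.
have cr := cvg_cell_avg _ iF.1; have ci := cvg_cell_avg _ iF.2.
apply: filterS2 cr ci => t cr ci Dt.
rewrite /cabs2; apply: cvgD; rewrite expr2.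
  have {}cr : complex.Re (h n t) @[n --> \oo] --> complex.Re (F t).
    under eq_fun do rewrite step_avgE// cReM /= mul0r subr0.
    exact: cr.
  by apply: cvgM.
have {}ci : complex.Im (h n t) @[n --> \oo] --> complex.Im (F t).
  under eq_fun do rewrite step_avgE// cImM /= mul0r addr0.
  exact: ci.
by apply: cvgM.
Qed.

(** A Fatou argument by truncation: min(|h n|^2, k) is dominated by the constant k and has integral
    at most S b, so the same bound holds for min(|F|^2, k). Then k tends to infinity under the
    majorant |F|^2. *)
Lemma nsq_le_fcoef (S : R) :
  (forall J : seq int, uniq J -> \sum_(n <- J) cabs2 (fcoef b T x0 F n) <= S) ->
  nsq D F <= S * b.
Proof.
move=> FS.
have hS n : nsq D (h n) <= S * b by exact: nsq_cell_avg.
have mF2 := measurable_cabs2 _ _ _ (cL2_meas _ _ _ lF).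
have lh n : cL2 D (h n) by exact: cL2_step.
have mh2 n := measurable_cabs2 _ _ _ (cL2_meas _ _ _ (lh n)).
have mmin (f : R -> R) K : measurable_fun D f -> measurable_fun D (fun t => Num.min (f t) K).
  by move=> mf; apply: measurable_minr => //; exact: measurable_cst.
have trunc (k : nat) : Rintegral mu D (fun t => Num.min (cabs2 (F t)) k%:R) <= S * b.
  have k0 : 0 <= k%:R :> R by [].
  have iK : mu.-integrable D (EFin \o (fun=> k%:R)).
    by apply: measurable_bounded_integrable => //; [exact: mu_itvco_fin|exact: bounded_cst].
  have [|n t Dt|_ c] := Rintegral_dominated _ D (fun n t => Num.min (cabs2 (h n t)) k%:R)
      (fun t => Num.min (cabs2 (F t)) k%:R) _ mD (fun n => mmin _ _ (mh2 n)) (mmin _ _ mF2) _ iK.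
  - apply: filterS cvg_step_avg => t + Dt => /(_ Dt) ct.
    rewrite minr_absE; under eq_fun do rewrite minr_absE.
    apply: cvgM; last exact: cvg_cst.
    have ck : (fun=> k%:R : R) n @[n --> \oo] --> (k%:R : R) by exact: cvg_cst.
    by apply: cvgB; [exact: cvgD|apply: cvg_norm; exact: cvgB].
  - by rewrite ger0_norm ?le_min ?cabs2_ge0//= ge_min lexx orbT.
  apply: (cvgr_to_le c); apply: nearW => n.
  apply: le_trans (hS n); apply: le_Rintegral => //.
  - apply: (le_integrable mD _ _ (cL2_integrable _ D _ mD (lh n))).
      by apply/measurable_EFinP; exact: mmin.
    move=> t _; rewrite /= lee_fin !ger0_norm ?le_min ?cabs2_ge0//=.
    by rewrite ge_min lexx.
  - exact: (cL2_integrable _ D _ mD (lh n)).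
  - by move=> t _; rewrite ge_min lexx.
have [||_ c] := Rintegral_dominated _ D (fun k t => Num.min (cabs2 (F t)) k%:R)
    (fun t => cabs2 (F t)) _ mD (fun k => mmin _ _ mF2) mF2 _ (cL2_integrable _ D _ mD lF).
- apply: aeW => t _; apply: cvg_near_cst.
  near=> k; apply/min_idPl.
  by near: k; exact: nbhs_infty_ger.
- by move=> k t _; rewrite ger0_norm ?le_min ?cabs2_ge0//= ge_min lexx.
by apply: (cvgr_to_le c); apply: nearW => k; exact: trunc.
Unshelve. all: by end_near. Qed.

End Completeness.

(** * Parseval and translations *)

Section Parseval.
Variable R : realType.
Local Notation mu := (@lebesgue_measure R).

(** Bessel gives one inequality and shows that the sum is finite; its value, now a real number,
    serves as the constant S of [nsq_le_fcoef] for the other. *)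
Lemma parseval (b T x0 : R) (F : R -> R[i]) : 0 < T -> b * T = 1 ->
  cL2 (`[x0, x0 + T[%classic : set (measurableTypeR R)) F ->
  (\esum_(n in [set: int]) (cabs2 (fcoef b T x0 F n))%:E =
   (T * nsq `[x0, x0 + T[ F)%:E)%E.
Proof.
move=> T0 bT lF; set s := (\esum_(n in _) _)%E.
have fsE (A : set int) : finite_set A ->
    (\sum_(n \in A) (cabs2 (fcoef b T x0 F n))%:E =
     (\sum_(n <- finmap.enum_fset (fset_set A)) cabs2 (fcoef b T x0 F n))%:E)%E.
  by move=> fA; rewrite fsbig_finite// sumEFin.
have sle : (s <= (T * nsq `[x0, x0 + T[ F)%:E)%E.
  apply: ge_ereal_sup => _ [A [fA _] <-].
  by rewrite fsE// lee_fin; apply: bessel => //; exact: finmap.fset_uniq.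
have s0 : (0 <= s)%E by apply: esum_ge0 => n _; rewrite lee_fin cabs2_ge0.
have sfin : s \is a fin_num by rewrite ge0_fin_numE// (le_lt_trans sle) ?ltry.
apply/eqP; rewrite eq_le sle /= -(fineK sfin) lee_fin.
have -> : fine s = T * (fine s * b) by rewrite mulrCA [T * b]mulrC bT mulr1.
rewrite ler_pM2l//; apply: nsq_le_fcoef => // J uJ.
rewrite -lee_fin fineK//; apply: ereal_sup_ubound.
exists [set` J]; first by split => //; exact: finite_seq.
by rewrite -fsbig_seq// sumEFin.
Qed.

End Parseval.

(** * Translation invariance, and integrals cut into equal pieces *)

Section Translation.
Variable R : realType.
Local Notation mu := (@lebesgue_measure R).

Local Notation ico x y := (`[x, y[%classic : set (measurableTypeR R)).

Definition translate (a : R) (t : measurableTypeR R) : measurableTypeR R := t + a.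

Lemma measurable_translate a : measurable_fun setT (translate a).
Proof.
apply: continuous_measurable_fun => t.
by apply: cvgD; [exact: cvg_id|exact: cvg_cst].
Qed.

HB.instance Definition _ a := isMeasurableFun.Build _ _ _ _ (translate a)
  (measurable_translate a).

Lemma translate_itv a (i1 i2 : bool) (x y : R) :
  translate a @^-1` [set` Interval (BSide i1 x) (BSide i2 y)] =
  [set` Interval (BSide i1 (x - a)) (BSide i2 (y - a))].
Proof.
apply/seteqP; split=> t; rewrite /= /translate !in_itv /=;
  by case: i1; case: i2 => /=; rewrite ?lerBlDr ?ltrBlDr ?lerBrDr ?ltrBrDr.
Qed.

(** Uniqueness of Lebesgue measure reduces the claim to intervals, whose length a translation
    preserves. *)
Lemma lebesgue_translate a (A : set (measurableTypeR R)) : measurable A ->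
  pushforward mu (translate a) A = mu A.
Proof.
move=> mA; apply/esym/(lebesgue_measure_unique (mu := pushforward mu (translate a))) => //.
move=> _ [[x y] _ <-] /=; rewrite /pushforward translate_itv !lebesgue_measure_itv /=.
rewrite !lte_fin ltrD2r; case: ifP => // _.
by rewrite -!EFinD; congr EFin; ring.
Qed.

Lemma ge0_integral_translate a (D : set (measurableTypeR R)) (f : R -> R) :
  measurable D -> measurable_fun D f -> (forall t, D t -> 0 <= f t) ->
  (\int[mu]_(t in D) (f t)%:E =
   \int[mu]_(t in translate a @^-1` D) (f (t + a))%:E)%E.
Proof.
move=> mD mf f0.
rewrite (eq_measure_integral (pushforward mu (translate a))); last first.
  by move=> A mA _; exact/esym/lebesgue_translate.
rewrite (ge0_integral_pushforward (measurable_translate a) mu mD)//.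
- exact/measurable_EFinP.
- by move=> t /set_mem Dt; rewrite lee_fin f0.
Qed.

Lemma integral_translate a (D : set (measurableTypeR R)) (f : R -> R) :
  measurable D -> measurable_fun setT f -> mu.-integrable D (EFin \o f) ->
  mu.-integrable (translate a @^-1` D) (EFin \o (fun t => f (t + a))) /\
  Rintegral mu D f = Rintegral mu (translate a @^-1` D) (fun t => f (t + a)).
Proof.
move=> mD mf fi.
have mfa : measurable_fun setT (fun t : measurableTypeR R => f (t + a)).
  exact: (measurableT_comp mf (measurable_translate a)).
have mDa : measurable (translate a @^-1` D).
  by rewrite -[X in measurable X]setTI; exact: measurable_translate.
have ia : mu.-integrable (translate a @^-1` D) (EFin \o (fun t => f (t + a))).
  apply/integrableP; split.
    by apply/measurable_EFinP; exact: measurable_funTS.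
  have /integrableP[_] := fi.
  rewrite /= (ge0_integral_translate a D (fun t => `|f t|))//.
  by apply: measurableT_comp => //; exact: measurable_funTS.
split=> //; rewrite /Rintegral; congr fine.
rewrite (eq_measure_integral (pushforward mu (translate a))); last first.
  by move=> A mA _; exact/esym/lebesgue_translate.
rewrite (integral_pushforward (measurable_translate a) _ _ mD)//.
exact/measurable_EFinP.
Qed.

Lemma itv_pieces (x0 T : R) n : 0 <= T ->
  `[x0, x0 + n.+1%:R * T[%classic =
  `[x0, x0 + n%:R * T[ `|` `[x0 + n%:R * T, x0 + n%:R * T + T[ :> set (measurableTypeR R).
Proof.
move=> T0; have nT : 0 <= n%:R * T by rewrite mulr_ge0.
rewrite (@itv_bndbnd_setU _ _ _ (BLeft (x0 + n%:R * T))) ?bnd_simp ?lerDl//.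
  by rewrite -addrA -[n.+1%:R]natr1 mulrDl mul1r.
by rewrite lerD2l ler_wpM2r// ler_nat.
Qed.

Lemma itv_disj (x y z : R) :
  [disjoint (`[x, y[%classic : set (measurableTypeR R)) & `[y, z[%classic].
Proof.
apply/disj_setPS => t [] /=; rewrite !in_itv /= => /andP[_ ty] /andP[yt _].
by move: (lt_le_trans ty yt); rewrite ltxx.
Qed.

Lemma translate_cell (x0 T s : R) :
  translate s @^-1` (`[x0 + s, x0 + s + T[%classic : set (measurableTypeR R)) =
  (`[x0, x0 + T[%classic : set (measurableTypeR R)).
Proof. by rewrite translate_itv addrK addrAC addrK. Qed.

(** Serves twice through its complex versions: to fold f onto one period of length 1/[beta], and to
    cut [psi] into its N cells of length [beta]. *)
Lemma Rintegral_pieces (x0 T : R) n (f : R -> R) : 0 <= T ->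
  measurable_fun (setT : set (measurableTypeR R)) f ->
  mu.-integrable `[x0, x0 + n%:R * T[ (EFin \o f) ->
  (forall j : 'I_n, mu.-integrable `[x0, x0 + T[ (EFin \o (fun t => f (t + j%:R * T)))) /\
  Rintegral mu `[x0, x0 + n%:R * T[ f =
  \sum_(j < n) Rintegral mu `[x0, x0 + T[ (fun t => f (t + j%:R * T)).
Proof.
move=> T0 mf; elim: n => [|n IH].
  move=> _; split; first by case.
  by rewrite mul0r addr0 set_itv_ge ?bnd_simp ?ltxx// Rintegral_set0 big_ord0.
rewrite itv_pieces// => fi.
have i1 : mu.-integrable `[x0, x0 + n%:R * T[ (EFin \o f).
  by apply: integrableS fi => //; apply: measurableU.
have i2 : mu.-integrable `[x0 + n%:R * T, x0 + n%:R * T + T[ (EFin \o f).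
  by apply: integrableS fi => //; apply: measurableU.
have [ij e] := IH i1.
have [i3 e3] := integral_translate (n%:R * T) _ f (measurable_itvT _ _) mf i2.
rewrite translate_cell in i3 e3.
split.
  move=> j; case: (unliftP ord_max j) => [k ->|-> //].
  by have := ij k; rewrite /= /bump leqNgt ltn_ord.
rewrite big_ord_recr /= -e -e3 Rintegral_setU//.
- exact: itv_disj.
Qed.

Lemma cint_pieces (x0 T : R) n (F : R -> R[i]) : 0 <= T ->
  cmeas setT F -> cintg `[x0, x0 + n%:R * T[ F ->
  (forall j : 'I_n, cintg `[x0, x0 + T[ (fun t => F (t + j%:R * T))) /\
  cint `[x0, x0 + n%:R * T[ F =
  \sum_(j < n) cint `[x0, x0 + T[ (fun t => F (t + j%:R * T)).
Proof.
move=> T0 [mr mi] [ir ii].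
have [jr er] := Rintegral_pieces x0 T n _ T0 mr ir.
have [ji ei] := Rintegral_pieces x0 T n _ T0 mi ii.
split; first by move=> j; split.
by apply: complex_ext; rewrite ?cRe_sum ?cIm_sum.
Qed.

Lemma cL2_pieces (x0 T : R) n (F : R -> R[i]) : 0 <= T ->
  cmeas setT F -> cL2 `[x0, x0 + n%:R * T[ F ->
  (forall j : 'I_n, cL2 `[x0, x0 + T[ (fun t => F (t + j%:R * T))) /\
  nsq `[x0, x0 + n%:R * T[ F =
  \sum_(j < n) nsq `[x0, x0 + T[ (fun t => F (t + j%:R * T)).
Proof.
move=> T0 mF lF.
have mF2 := measurable_cabs2 _ _ _ mF.
have iF := cL2_integrable _ _ _ (measurable_itvT _ _) lF.
have [ij e] := Rintegral_pieces x0 T n _ T0 mF2 iF.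
split=> // j; split.
  have mt := measurable_translate (j%:R * T).
  by split; apply: measurable_funTS;
    [exact: (measurableT_comp mF.1 mt)|exact: (measurableT_comp mF.2 mt)].
exact: integrable_lty (ij j).
Qed.

End Translation.

(** * The estimate on a fibre *)

Section Support.
Variable R : realType.
Implicit Types (D A : set (measurableTypeR R)) (F : R -> R[i]).

Lemma cint_supp D A F : A `<=` D -> (forall t, D t -> ~ A t -> F t = 0) ->
  cint D F = cint A F.
Proof.
move=> AD F0; rewrite -(cint_indic _ D A F AD); apply: eq_cint => t Dt.
rewrite /cindic indicE; have [tA|/negP tA] := boolP (t \in A).
  by rewrite mulr1.
by rewrite F0 ?mul0r// => At; apply: tA; exact: mem_set.
Qed.

Lemma nsq_supp D A F : A `<=` D -> (forall t, D t -> ~ A t -> F t = 0) ->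
  nsq D F = nsq A F.
Proof.
move=> AD F0; apply: complexI; rewrite -!cint_nsq; apply: cint_supp => // t Dt At.
by rewrite F0// mul0r.
Qed.

Lemma esum_le_scale (u v : int -> R) (q X : R) : 0 <= q ->
  (forall m, 0 <= v m) -> (forall m, u m <= q * v m) ->
  (\esum_(m in [set: int]) (v m)%:E <= X%:E)%E ->
  (\esum_(m in [set: int]) (u m)%:E <= (q * X)%:E)%E.
Proof.
move=> q0 v0 uv vX; apply: ge_ereal_sup => _ [A [fA _] <-].
rewrite fsbig_finite// sumEFin lee_fin.
apply: (@le_trans _ _ (\sum_(m <- finmap.enum_fset (fset_set A)) q * v m)).
  by apply: ler_sum => m _; exact: uv.
rewrite -mulr_sumr ler_wpM2l// -lee_fin; apply: le_trans vX.
by apply: ereal_sup_ubound; exists A => //; rewrite fsbig_finite// sumEFin.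
Qed.

End Support.

(** * The exponential sums [Vr] and the multiplier [Qm] *)

Section Fiber.
Variables (R : realType) (N : nat) (a om : 'I_N -> R[i]) (alpha beta : R).
Hypotheses (N0 : (0 < N)%N) (beta0 : 0 < beta) (ha : forall k, a k != 0)
  (hom : forall k, complex.Re (om k) != 0)
  (homd : forall k l, k != l -> complex.Re (om k) != complex.Re (om l)).

Definition nu (k : 'I_N) : R[i] := cexp (om k * beta%:C%C).

(** What remains of [Qm], as a polynomial in E, after its k-th factor has cleared the k-th
    denominator. *)
Definition lagr (k : 'I_N) : {poly R[i]} := \prod_(l | l != k) (nu l *: 'X - 1).

(** N - 1 linear factors leave N coefficients, one for each cell of [psi]. *)
Lemma size_lagr k : (size (lagr k) <= N)%N.
Proof.
have szf l : size (nu l *: 'X - 1 : {poly R[i]}) = 2%N.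
  rewrite size_polyDl size_scale ?cexp_neq0// size_polyX//.
  by rewrite size_polyN size_poly1.
apply: (leq_trans (size_poly_prod_leq _ _)).
rewrite (eq_bigr (fun=> 2%N)); last by move=> l _; exact: szf.
rewrite sum_nat_const; have := cardC1 k; rewrite card_ord => cN.
have -> : #|[pred l | l != k]| = N.-1 by rewrite -cN; apply: eq_card.
have h p : ((p * 2).+1 - p <= p.+1)%N by rewrite muln2 -addnn subSn ?leq_addr// addnK.
by have := h N.-1; rewrite prednK.
Qed.

Lemma lagrE k x : (lagr k).[x] = \prod_(l | l != k) (nu l * x - 1).
Proof. by rewrite horner_prod; apply: eq_bigr => l _; rewrite !hornerE. Qed.

Lemma lagr_sum k x : (lagr k).[x] = \sum_(r < N) (lagr k)`_r * x ^+ r.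
Proof. exact: horner_coef_wide (size_lagr k). Qed.

(** The coefficient of X^r in sum_k a_k [lagr k] exp(om_k xi). As a factor E^r is a shift by r
    cells, this is the profile carried by the r-th cell. *)
Definition Vr (r : 'I_N) (xi : R) : R[i] :=
  \sum_k a k * (lagr k)`_r * cexp (om k * xi%:C%C).

Lemma cabs2_cexp_le (z : R[i]) (x : R) : 0 <= x <= beta ->
  expR (- (2 * `|complex.Re z| * beta)) <= cabs2 (cexp (z * x%:C%C)) <=
  expR (2 * `|complex.Re z| * beta).
Proof.
move=> /andP[x0 xb]; rewrite cabs2_cexp cReM /= mulr0 subr0 !ler_expR.
have h : `|complex.Re z * x| <= `|complex.Re z| * beta.
  by rewrite normrM ler_wpM2l// ger0_norm.
by move: h; rewrite ler_norml => /andP[h1 h2]; apply/andP; split; lra.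
Qed.

Lemma Vr_upper : exists v1, 0 < v1 /\
  forall xi, 0 <= xi <= beta -> \sum_(r < N) cabs2 (Vr r xi) <= v1.
Proof.
pose v1 := \sum_(r < N) N%:R * (\sum_k cabs2 (a k * (lagr k)`_r) *
  expR (2 * `|complex.Re (om k)| * beta)).
have v10 : 0 <= v1.
  apply: sumr_ge0 => r _; rewrite mulr_ge0// sumr_ge0// => k _.
  by rewrite mulr_ge0 ?cabs2_ge0 ?expR_ge0.
(* The sum v1 is only known to be nonnegative; adding 1 makes the constant positive. *)
exists (v1 + 1); split; first by rewrite ltr_wpDl.
move=> xi xiI; apply: (@le_trans _ _ v1); last by rewrite lerDl.
apply: ler_sum => r _; rewrite (le_trans (cabs2_sum_le _ _ _))// ler_wpM2l//.
apply: ler_sum => k _; rewrite cabs2M ler_wpM2l ?cabs2_ge0//.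
by have /andP[] := cabs2_cexp_le (om k) xi xiI.
Qed.

Lemma nu_inj : injective nu.
Proof.
move=> k l e; apply/eqP/negPn/negP => kl.
have := congr1 (@cabs2 R) e; rewrite /nu !cabs2_cexp !cReM /= !mulr0 !subr0.
move=> /expR_inj /(mulfI (_ : 2 != 0)) h.
have /(mulIf (_ : beta != 0)) e2 : complex.Re (om k) * beta = complex.Re (om l) * beta.
  by apply: h; rewrite pnatr_eq0.
by have := homd _ _ kl; rewrite e2 ?eqxx// gt_eqF.
Qed.

(* Evaluating sum_r V_r X^r at 1 / nu_k kills all terms but the k-th, because
   the lagr_l are Lagrange-type polynomials at the distinct points 1 / nu_l. *)
Lemma Vr_lower : exists v0, 0 < v0 /\
  forall xi, 0 <= xi <= beta -> v0 <= \sum_(r < N) cabs2 (Vr r xi).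
Proof.
pose k0 := Ordinal N0; pose x := (nu k0)^-1.
pose D := \sum_(r < N) cabs2 (x ^+ r).
have nu0 l : nu l != 0 by exact: cexp_neq0.
have x0 : x != 0 by rewrite invr_eq0.
have D0 : 0 < D.
  rewrite /D (bigD1 k0)//= ltr_pwDl ?cabs2_gt0 ?expf_neq0//.
  by apply: sumr_ge0 => r _; exact: cabs2_ge0.
(* m bounds from below the squared modulus of sum_r V_r x^r at x = 1 / nu_k0; Cauchy-Schwarz against
   the powers of x then costs the factor D. *)
pose m := cabs2 (a k0) * cabs2 (lagr k0).[x] * expR (- (2 * `|complex.Re (om k0)| * beta)).
have P0 : (lagr k0).[x] != 0.
  rewrite lagrE; apply/prodf_neq0 => l lk; rewrite subr_eq0.
  apply: contra lk => /eqP h; apply/eqP/nu_inj.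
  by rewrite -[LHS]mulr1 -(mulVf (nu0 k0)) mulrA h mul1r.
have m0 : 0 < m by rewrite !mulr_gt0 ?cabs2_gt0 ?expR_gt0.
exists (m / D); split; first by rewrite divr_gt0.
move=> xi xiI; rewrite ler_pdivrMr//.
apply: le_trans (cabs2_sum_mul _ _ _ _ _).
have -> : \sum_(r < N) Vr r xi * x ^+ r = a k0 * (lagr k0).[x] * cexp (om k0 * xi%:C%C).
  transitivity (\sum_k a k * (lagr k).[x] * cexp (om k * xi%:C%C)).
    under eq_bigr do rewrite /Vr mulr_suml.
    rewrite exchange_big /=; apply: eq_bigr => k _.
    rewrite lagr_sum mulr_sumr mulr_suml; apply: eq_bigr => r _; ring.
  rewrite (bigD1 k0)//= big1 ?addr0// => k kk0.
  rewrite lagrE (bigD1 k0) 1?eq_sym//= /x divff//.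
  by rewrite subrr mul0r mulr0 mul0r.
rewrite !cabs2M ler_wpM2l ?mulr_ge0 ?cabs2_ge0//.
by have /andP[] := cabs2_cexp_le (om k0) xi xiI.
Qed.

Definition Em (t : R) (m : int) : R[i] := cexpi (2 * pi * beta * (t - alpha * m%:~R)).

Definition Qm t m : R[i] := \prod_k (nu k * Em t m - 1).

(** The modulus of [nu k]. *)
Let rho k := expR (beta * complex.Re (om k)).

Lemma cabs2_nuE t m k : cabs2 (nu k * Em t m) = rho k ^+ 2.
Proof.
rewrite cabs2M cabs2_cexpi mulr1 cabs2_cexp cReM /= mulr0 subr0.
by rewrite /rho -expRM_natl mulrC [beta * _]mulrC mulrC.
Qed.

(** The lower bound is the reverse triangle inequality: |x - 1|^2 = |x|^2 - 2 Re x + 1 and Re x <=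
    |x|. *)
Lemma cabs2_sub1 (x : R[i]) (r : R) : 0 <= r -> cabs2 x = r ^+ 2 ->
  (r - 1) ^+ 2 <= cabs2 (x - 1) <= 2 * r ^+ 2 + 2.
Proof.
move=> r0 xr; apply/andP; split; last by rewrite (le_trans (cabs2B_le _ _ _))// xr cabs21 mulr1.
have rx : complex.Re x <= r.
  rewrite (le_trans (ler_norm _))// -(ler_pXn2r (n := 2))// ?nnegrE//.
  by rewrite real_normK ?num_real// -xr Re2_le_cabs2.
rewrite /cabs2 cReD cImD cReN cImN /=.
by move: xr; rewrite /cabs2 => xr; nra.
Qed.

Lemma Qm_bounds : exists q0 q1, [/\ 0 < q0, 0 < q1 &
  forall t m, q0 <= cabs2 (Qm t m) <= q1].
Proof.
exists (\prod_k (rho k - 1) ^+ 2), (\prod_k (2 * rho k ^+ 2 + 2)); split.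
- apply: prodr_gt0 => k _; rewrite exprn_even_gt0//= subr_eq0.
  rewrite -expR0 /rho; apply/eqP => /expR_inj /eqP.
  by rewrite mulf_eq0 gt_eqF//= (negbTE (hom k)).
- by apply: prodr_gt0 => k _; rewrite ltr_wpDl// mulr_ge0// sqr_ge0.
- move=> t m; rewrite /Qm cabs2_prod.
  have h k := cabs2_sub1 _ (rho k) (expR_ge0 _) (cabs2_nuE t m k).
  apply/andP; split; apply: ler_prod => k _; have /andP[h1 h2] := h k.
    by rewrite sqr_ge0.
  by rewrite cabs2_ge0.
Qed.

End Fiber.

(** * The two-sided estimate for a finite fibre *)

Section FiberBounds.
Variables (R : realType) (N : nat) (a om : 'I_N -> R[i]) (alpha beta : R).
Hypotheses (N0 : (0 < N)%N) (alpha0 : 0 < alpha) (beta0 : 0 < beta)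
  (abN : alpha * beta * N%:R <= 1) (ha : forall k, a k != 0)
  (hom : forall k, complex.Re (om k) != 0)
  (homd : forall k l, k != l -> complex.Re (om k) != complex.Re (om l)).

Let T := beta^-1.
Let Tb : T * beta = 1. Proof. by rewrite mulVf// gt_eqF. Qed.

Local Notation ico x y := (`[x, y[%classic : set (measurableTypeR R)).
Local Notation mu := (@lebesgue_measure R).

(** The conjugate of g in other parameters: each denominator is the exponent 2 pi i y + om_k of the
    exponential whose integral produces the fraction. *)
Definition ratfun (y : R) : R[i] := \sum_k a k / (ci R * (2 * pi * y)%:C%C + om k).

Section Coefficients.
Variables (t : R) (n : nat) (c : 'I_n -> R[i]).

Definition Cfun (xi : R) : R[i] := \sum_j c j * echar T (nat_of_ord j)%:Z xi.

Definition Sm (m : int) : R[i] :=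
  \sum_j c j * ratfun (t + j%:R * T - alpha * m%:~R).

Definition Wfun (eta : R) : R[i] :=
  \sum_(r < N) Vr R N a om beta r (eta - r%:R * beta) *
    cindic R (ico (r%:R * beta) (r.+1%:R * beta)) eta.

(** As [Cfun] has period [beta], on the r-th cell this is [Cfun] times the translate of [Vr r], up
    to a factor of modulus 1. *)
Definition psi (eta : R) : R[i] := cexpi (2 * pi * t * eta) * Cfun eta * Wfun eta.

Lemma cmeas_cexpi_lin (D : set (measurableTypeR R)) (p : R) : measurable D ->
  cmeas D (fun x => cexpi (p * x)).
Proof.
move=> mD; have := cmeas_cexp _ D (ci R * p%:C%C) mD.
by apply: eq_cmeas => x _; rewrite cexpiE rmorphM mulrA.
Qed.

Lemma cmeas_Cfun (D : set (measurableTypeR R)) : measurable D -> cmeas D Cfun.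
Proof.
by move=> mD; apply: cmeas_sum => j; apply: cmeasM; [exact: cmeas_cst|exact: cmeas_echar].
Qed.

Lemma cmeas_Vr (D : set (measurableTypeR R)) r s : measurable D ->
  cmeas D (fun x => Vr R N a om beta r (x - s)).
Proof.
move=> mD; apply: cmeas_sum => k; apply: cmeasM; first exact: cmeas_cst.
have := cmeasM _ _ _ _ (cmeas_cexp _ D (om k) mD) (cmeas_cst _ D (cexp (- (om k * s%:C%C)))).
by apply: eq_cmeas => x _; rewrite -cexpD rmorphB mulrBr.
Qed.

Lemma cmeas_psi : cmeas setT psi.
Proof.
apply: cmeasM; first by apply: cmeasM; [exact: cmeas_cexpi_lin|exact: cmeas_Cfun].
apply: cmeas_sum => r; apply: cmeasM; first exact: cmeas_Vr.
by apply: cmeas_indic; exact: measurable_itvT.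
Qed.

Lemma Wfun_shift (r : 'I_N) xi : 0 <= xi < beta ->
  Wfun (xi + r%:R * beta) = Vr R N a om beta r xi.
Proof.
move=> /andP[x0 xb]; rewrite /Wfun (bigD1 r)//= big1 => [|s sr].
  rewrite addr0 addrK /cindic indicE mem_set ?mulr1//= in_itv /=.
  by rewrite lerDr x0 -[r.+1%:R]natr1 mulrDl mul1r addrC ltrD2l.
rewrite /cindic indicE memNset ?mulr0//= in_itv /= => /andP[h1 h2].
have {}h1 : s%:R < r.+1%:R :> R.
  by rewrite -(ltr_pM2r beta0) (le_lt_trans h1)// -[r.+1%:R]natr1 mulrDl mul1r addrC ltrD2l.
have {}h2 : r%:R < s.+1%:R :> R.
  by rewrite -(ltr_pM2r beta0) (le_lt_trans _ h2)// lerDr.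
move: h1 h2 sr; rewrite !ltr_nat !ltnS => h1 h2 /eqP[].
by apply/val_inj/eqP; rewrite eqn_leq h1 h2.
Qed.

Lemma Wfun_supp eta : 0 <= eta -> ~ ico 0 (N%:R * beta) eta -> Wfun eta = 0.
Proof.
move=> e0 nI; rewrite /Wfun big1// => r _.
rewrite /cindic indicE memNset ?mulr0//= in_itv /= => /andP[_ h]; apply: nI.
rewrite /= in_itv /= e0 /= (lt_le_trans h)// ler_wpM2r ?(ltW beta0)//.
by rewrite ler_nat.
Qed.

Lemma Cfun_shift (r : nat) xi : Cfun (xi + r%:R * beta) = Cfun xi.
Proof. by apply: eq_bigr => j _; rewrite (echar_shift _ _ _ _ _ r%:Z). Qed.

Lemma psi_shift (r : 'I_N) xi : 0 <= xi < beta -> psi (xi + r%:R * beta) =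
  cexpi (2 * pi * t * (xi + r%:R * beta)) * Cfun xi * Vr R N a om beta r xi.
Proof. by move=> h; rewrite /psi Wfun_shift// Cfun_shift. Qed.

(** The density condition [alpha * beta * N%:R <= 1] enters here. The end point 0 + 1/[alpha] is
    left unsimplified to match x0 + T at x0 = 0. *)
Lemma ico_Nbeta_sub : ico 0 (N%:R * beta) `<=` ico 0 (0 + alpha^-1).
Proof.
move=> x /=; rewrite !in_itv /= add0r => /andP[-> h] /=.
rewrite (lt_le_trans h)// -(ler_pM2l alpha0) divff ?gt_eqF//.
by have -> : alpha * (N%:R * beta) = alpha * beta * N%:R by ring.
Qed.

Lemma psi_supp eta : ico 0 (0 + alpha^-1) eta -> ~ ico 0 (N%:R * beta) eta -> psi eta = 0.
Proof.
rewrite /= in_itv /= => /andP[e0 _] nI.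
by rewrite /psi Wfun_supp ?mulr0.
Qed.

Lemma cabs2_Vr_bnd : exists v, 0 < v /\ forall (r : 'I_N) xi, 0 <= xi <= beta ->
  cabs2 (Vr R N a om beta r xi) <= v.
Proof.
have [v [v0 hv]] := Vr_upper R N a om beta.
exists v; split=> // r xi /hv; apply: le_trans; rewrite (bigD1 r)//= lerDl.
by apply: sumr_ge0 => s _; exact: cabs2_ge0.
Qed.

Lemma cL2_psi (x y : R) : cL2 (ico x y) psi.
Proof.
have [v [v0 hv]] := cabs2_Vr_bnd.
apply: (cL2_bnd _ _ _ ((n%:R * \sum_j cabs2 (c j)) * (N%:R * \sum_(r < N) v))).
- exact: measurable_itvT.
- exact: mu_itvco_fin.
- by apply: cmeasS cmeas_psi => //; exact: measurableT.
- move=> eta _; rewrite /psi !cabs2M cabs2_cexpi mul1r.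
  apply: ler_pM; rewrite ?cabs2_ge0//; rewrite (le_trans (cabs2_sum_le _ _ _))// ler_wpM2l//.
    by apply: ler_sum => j _; rewrite cabs2M cabs2_echar mulr1.
  apply: ler_sum => r _; rewrite cabs2M /cindic cabs2_real indicE.
  have [etaI|_] := boolP (eta \in _); last by rewrite expr0n mulr0 ltW.
  rewrite expr1n mulr1 hv//; move: etaI; rewrite inE /= in_itv /= => /andP[h1 h2].
  by rewrite subr_ge0 h1 lerBlDr addrC ltW// -[X in _ + X]mul1r -mulrDl natr1.
Qed.

Lemma icoP x : ico 0 (0 + beta) x -> 0 <= x < beta.
Proof. by rewrite /= in_itv /= add0r. Qed.

(* Parseval on a period of length 1 / alpha, which contains the support
   [0, N beta) of psi because alpha beta <= 1 / N. *)
Lemma esum_fcoef_psi :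
  (\esum_(m in [set: int]) (cabs2 (fcoef alpha alpha^-1 0 psi m))%:E =
   (alpha^-1 * \sum_(r < N) nsq (ico 0 (0 + beta))
      (fun xi => Cfun xi * Vr R N a om beta r xi))%:E)%E.
Proof.
rewrite parseval ?invr_gt0 ?divff ?gt_eqF//; last exact: cL2_psi.
rewrite (nsq_supp _ _ _ _ ico_Nbeta_sub psi_supp).
have [_ e] := cL2_pieces _ 0 beta N psi (ltW beta0) cmeas_psi (cL2_psi _ _).
rewrite add0r in e; rewrite e; congr (_ * _)%:E; apply: eq_bigr => r _.
apply: complexI; rewrite -!cint_nsq; apply: eq_cint => x /icoP xI.
rewrite -!cabs2E psi_shift//; congr (_%:C%C).
by rewrite -mulrA cabs2M cabs2_cexpi mul1r.
Qed.

Lemma den_neq0 y k : ci R * (2 * pi * y)%:C%C + om k != 0.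
Proof.
apply/eqP => /(congr1 (@complex.Re R)); rewrite cReD cReM /= mul0r mulr0 subrr add0r.
by move/eqP; rewrite (negbTE (hom k)).
Qed.

(** The summand j T of y contributes exp(2 pi i j) = 1. The value is thus the same for all j, which
    is why one multiplier [Qm] works for the whole sum [Sm]. *)
Lemma Em_cexp (j : 'I_n) m k : let y := t + j%:R * T - alpha * m%:~R in
  cexp ((ci R * (2 * pi * y)%:C%C + om k) * beta%:C%C) =
  nu R N om beta k * Em R alpha beta t m.
Proof.
move=> y; rewrite mulrDl cexpD mulrC; congr (_ * _).
rewrite -mulrA -rmorphM -cexpiE /Em.
have -> : 2 * pi * y * beta =
    2 * pi * beta * (t - alpha * m%:~R) + 2 * pi * j%:R * (T * beta).
  by rewrite /y; ring.
by rewrite Tb mulr1 cexpiD cexpi_nat mulr1.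
Qed.

Lemma cexp_split (j : 'I_n) m k xi : let y := t + j%:R * T - alpha * m%:~R in
  cexp ((ci R * (2 * pi * y)%:C%C + om k) * xi%:C%C) =
  cexpi (2 * pi * t * xi) * conjc (echar alpha m xi) * echar T j%:Z xi *
   cexp (om k * xi%:C%C).
Proof.
move=> y; rewrite mulrDl cexpD; congr (_ * _).
rewrite -mulrA -rmorphM -cexpiE /echar -cexpiN -!cexpiD; congr cexpi.
by rewrite /y -pmulrn; ring.
Qed.

Lemma cint_resolvent (j : 'I_n) m k : let y := t + j%:R * T - alpha * m%:~R in
  cintg (ico 0 (0 + beta)) (fun xi => cexpi (2 * pi * t * xi) *
      conjc (echar alpha m xi) * echar T j%:Z xi * cexp (om k * xi%:C%C)) /\
  (nu R N om beta k * Em R alpha beta t m - 1) / (ci R * (2 * pi * y)%:C%C + om k) =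
  cint (ico 0 (0 + beta)) (fun xi => cexpi (2 * pi * t * xi) *
      conjc (echar alpha m xi) * echar T j%:Z xi * cexp (om k * xi%:C%C)).
Proof.
move=> y; have b0 : 0 <= 0 + beta by rewrite add0r ltW.
have [i e] := cint_cexp _ _ 0 (0 + beta) b0 (den_neq0 y k).
split; first by apply: eq_cintg i => // xi _; exact: cexp_split.
have <- := Em_cexp j m k; rewrite -/y.
transitivity (cint (ico 0 (0 + beta))
    (fun xi => cexp ((ci R * (2 * pi * y)%:C%C + om k) * xi%:C%C))).
  by rewrite e rmorph0 mulr0 cexp0 add0r.
by apply: eq_cint => xi _; exact: cexp_split.
Qed.

Lemma cexpiX (x : R) (r : nat) : cexpi x ^+ r = cexpi (r%:R * x).
Proof.
elim: r => [|r IH]; first by rewrite mul0r cexpi0.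
by rewrite exprSr IH -cexpiD -[r.+1%:R]natr1 mulrDl mul1r.
Qed.

(** This is what turns the powers of E in the expansion of [lagr] into positions of cells. *)
Lemma modulation_shift m (r : nat) xi :
  cexpi (2 * pi * t * (xi + r%:R * beta)) * conjc (echar alpha m (xi + r%:R * beta)) =
  Em R alpha beta t m ^+ r * (cexpi (2 * pi * t * xi) * conjc (echar alpha m xi)).
Proof.
rewrite /Em /echar cexpiX -!cexpiN -!cexpiD; congr cexpi.
by ring.
Qed.

Lemma fcoef_psi m : fcoef alpha alpha^-1 0 psi m =
  \sum_(r < N) Em R alpha beta t m ^+ r * cint (ico 0 (0 + beta))
    (fun xi => cexpi (2 * pi * t * xi) * conjc (echar alpha m xi) *
      (Cfun xi * Vr R N a om beta r xi)).
Proof.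
have b0 : 0 <= beta by exact: ltW.
pose G eta := psi eta * conjc (echar alpha m eta).
have mG : cmeas setT G.
  by apply: cmeasM; [exact: cmeas_psi|apply: cmeasJ => //; exact: cmeas_echar].
have iG : cintg (ico 0 (0 + N%:R * beta)) G.
  by apply: cL2_cintg; [exact: measurable_itvT|exact: cL2_psi|exact: cL2_echar].
rewrite /fcoef -/G (cint_supp _ _ _ _ ico_Nbeta_sub); last first.
  by move=> eta e1 e2; rewrite /G psi_supp ?mul0r.
have [iGr e] := cint_pieces _ 0 beta N G b0 mG iG.
rewrite add0r in e; rewrite e; apply: eq_bigr => r _.
(* E^r is invertible, so integrability of the r-th piece of G passes to the integrand without this
   factor, as [cintZ] demands. *)
have Er0 : Em R alpha beta t m ^+ r != 0.
  by rewrite expf_neq0// /Em -cabs2_eq0 cabs2_cexpi oner_eq0.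
have GE xi : ico 0 (0 + beta) xi -> G (xi + r%:R * beta) =
    Em R alpha beta t m ^+ r * (cexpi (2 * pi * t * xi) * conjc (echar alpha m xi) *
      (Cfun xi * Vr R N a om beta r xi)).
  move=> /icoP xI; rewrite /G psi_shift//.
  transitivity (cexpi (2 * pi * t * (xi + r%:R * beta)) *
     conjc (echar alpha m (xi + r%:R * beta)) * (Cfun xi * Vr R N a om beta r xi)).
    by ring.
  by rewrite modulation_shift; ring.
rewrite -cintZ; [exact: eq_cint|exact: measurable_itvT|].
have i1 := cintgZ _ _ _ (Em R alpha beta t m ^+ r)^-1 (measurable_itvT _ _) (iGr r).
apply: eq_cintg i1 => [|xi xI]; first exact: measurable_itvT.
by rewrite GE// mulrA mulVf// mul1r.
Qed.

(** In the k-th fraction the factor nu_k E - 1 over the denominator becomes an integral over one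
    cell; the remaining factors are [lagr k] at E, whose r-th monomial moves that integral to the
    r-th cell. *)
Lemma Qm_Sm m : Qm R N om alpha beta t m * Sm m = fcoef alpha alpha^-1 0 psi m.
Proof.
set E := Em R alpha beta t m.
pose I (j : 'I_n) k := cint (ico 0 (0 + beta)) (fun xi => cexpi (2 * pi * t * xi) *
      conjc (echar alpha m xi) * echar T j%:Z xi * cexp (om k * xi%:C%C)).
have iI (j : 'I_n) k : cintg (ico 0 (0 + beta)) (fun xi => cexpi (2 * pi * t * xi) *
      conjc (echar alpha m xi) * echar T j%:Z xi * cexp (om k * xi%:C%C)).
  by have [] := cint_resolvent j m k.
have IE (r : 'I_N) : cint (ico 0 (0 + beta))
    (fun xi => cexpi (2 * pi * t * xi) * conjc (echar alpha m xi) *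
      (Cfun xi * Vr R N a om beta r xi)) =
    \sum_j \sum_k c j * (a k * (lagr R N om beta k)`_r) * I j k.
  transitivity (cint (ico 0 (0 + beta)) (fun xi => \sum_j \sum_k
      (c j * (a k * (lagr R N om beta k)`_r)) * (cexpi (2 * pi * t * xi) *
      conjc (echar alpha m xi) * echar T j%:Z xi * cexp (om k * xi%:C%C)))).
    apply: eq_cint => xi _; rewrite /Cfun /Vr mulr_suml mulr_sumr; apply: eq_bigr => j _.
    by rewrite !mulr_sumr; apply: eq_bigr => k _; ring.
  have mI : measurable (ico 0 (0 + beta)) by exact: measurable_itvT.
  rewrite cint_sum//; last first.
    by move=> j; apply: cintg_sum => // k; exact: cintgZ.
  apply: eq_bigr => j _; rewrite cint_sum//; last by move=> k; exact: cintgZ.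
  by apply: eq_bigr => k _; rewrite cintZ.
rewrite fcoef_psi -/E.
under eq_bigr do rewrite IE mulr_sumr.
rewrite exchange_big /= /Sm mulr_sumr; apply: eq_bigr => j _.
under [RHS]eq_bigr do rewrite mulr_sumr.
rewrite exchange_big /= /ratfun !mulr_sumr; apply: eq_bigr => k _.
have QE : Qm R N om alpha beta t m =
    (nu R N om beta k * E - 1) * (lagr R N om beta k).[E].
  by rewrite /Qm (bigD1 k)//= lagrE.
have [_ e] := cint_resolvent j m k; rewrite -/E -/(I j k) in e.
rewrite QE lagr_sum//.
transitivity (((nu R N om beta k * E - 1) /
   (ci R * (2 * pi * (t + j%:R * T - alpha * m%:~R))%:C%C + om k)) *
   (c j * a k * \sum_(r < N) (lagr R N om beta k)`_r * E ^+ r)); first by ring.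
rewrite e mulrA mulr_sumr; apply: eq_bigr => r _.
by ring.
Qed.

Lemma nsq_Cfun : nsq (ico 0 (0 + beta)) Cfun = beta * \sum_j cabs2 (c j).
Proof. by apply: nsq_expsum => // i j [] /val_inj. Qed.

Lemma cL2_Cfun : cL2 (ico 0 (0 + beta)) Cfun.
Proof. exact: cL2_expsum. Qed.

(** After summation over r, |Cfun|^2 carries the weight sum_r |V_r|^2. Only this sum, not the single
    [Vr], is bounded below. *)
Lemma sum_nsq_CV v0 v1 :
  (forall xi, 0 <= xi <= beta -> v0 <= \sum_(r < N) cabs2 (Vr R N a om beta r xi) <= v1) ->
  v0 * (beta * \sum_j cabs2 (c j)) <=
  \sum_(r < N) nsq (ico 0 (0 + beta)) (fun xi => Cfun xi * Vr R N a om beta r xi) <=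
  v1 * (beta * \sum_j cabs2 (c j)).
Proof.
move=> hv; rewrite -nsq_Cfun.
have mI : measurable (ico 0 (0 + beta)) by exact: measurable_itvT.
have [v [_ hV]] := cabs2_Vr_bnd.
have lCV (r : 'I_N) : cL2 (ico 0 (0 + beta)) (fun xi => Cfun xi * Vr R N a om beta r xi).
  have := cL2_bndM _ _ _ _ v mI cL2_Cfun (cmeas_Vr (ico 0 (0 + beta)) r 0 mI).
  have /[swap]/[apply] : forall xi, ico 0 (0 + beta) xi -> cabs2 (Vr R N a om beta r (xi - 0)) <= v.
    by move=> xi /icoP /andP[x0 xb]; rewrite subr0 hV// x0 ltW.
  by apply: eq_cL2 => xi _; rewrite subr0 mulrC.
have iCV r := cL2_integrable _ _ _ mI (lCV r).
have iC := cL2_integrable _ _ _ mI cL2_Cfun.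
have -> : \sum_(r < N) nsq (ico 0 (0 + beta)) (fun xi => Cfun xi * Vr R N a om beta r xi) =
    Rintegral mu (ico 0 (0 + beta))
      (fun xi => \sum_(r < N) cabs2 (Cfun xi * Vr R N a om beta r xi)).
  rewrite /nsq /Rintegral.
  under [in RHS]eq_integral do rewrite -sumEFin.
  rewrite integral_sum//.
  by rewrite sum_fine// => r _; exact: integrable_fin_num.
have iS : mu.-integrable (ico 0 (0 + beta))
    (EFin \o (fun xi => \sum_(r < N) cabs2 (Cfun xi * Vr R N a om beta r xi))).
  have isum := integrable_sum mI (index_enum 'I_N) (fun (r : 'I_N) (_ : xpredT r) => iCV r).
  apply: (eq_integrable mI _ _ _ isum).
  by move=> xi _; rewrite /= sumEFin.
have iZ (q : R) : mu.-integrable (ico 0 (0 + beta)) (EFin \o (fun xi => q * cabs2 (Cfun xi))).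
  by apply: (eq_integrable mI _ _ _ (integrableZl mI q iC)).
have sE xi : \sum_(r < N) cabs2 (Cfun xi * Vr R N a om beta r xi) =
    (\sum_(r < N) cabs2 (Vr R N a om beta r xi)) * cabs2 (Cfun xi).
  by rewrite mulr_suml; apply: eq_bigr => r _; rewrite cabs2M mulrC.
have hx xi : ico 0 (0 + beta) xi ->
    v0 <= \sum_(r < N) cabs2 (Vr R N a om beta r xi) <= v1.
  by move=> /icoP /andP[x0 xb]; apply: hv; rewrite x0 ltW.
rewrite /nsq -!RintegralZl//; apply/andP; split; apply: le_Rintegral => // xi xI;
  have /andP[h1 h2] := hx xi xI; by rewrite sE ler_wpM2r ?cabs2_ge0.
Qed.

End Coefficients.

(** The constants depend neither on t nor on n, which allows integration over t and, later, a
    growing support of f. *)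
Lemma fiber_bounds : exists A B : R, [/\ 0 < A, 0 < B &
  forall (t : R) n (c : 'I_n -> R[i]),
  ((A * \sum_j cabs2 (c j))%:E <= \esum_(m in [set: int]) (cabs2 (Sm t n c m))%:E)%E /\
  (\esum_(m in [set: int]) (cabs2 (Sm t n c m))%:E <= (B * \sum_j cabs2 (c j))%:E)%E].
Proof.
have [v1 [v10 hv1]] := Vr_upper R N a om beta.
have [v0 [v00 hv0]] := Vr_lower R N a om beta N0 beta0 ha homd.
have [q0 [q1 [q00 q10 hq]]] := Qm_bounds R N om alpha beta beta0 hom.
have a1 : 0 < alpha^-1 by rewrite invr_gt0.
(* The q come from dividing by [Qm], 1/[alpha] from Parseval in m, [beta] from Parseval in j, and
   the v from the weight sum_r |V_r|^2. *)
exists (q1^-1 * (alpha^-1 * (v0 * beta))), (q0^-1 * (alpha^-1 * (v1 * beta))).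
split; [by rewrite !mulr_gt0 ?invr_gt0|by rewrite !mulr_gt0 ?invr_gt0|move=> t n c].
have /andP[X0 X1] := sum_nsq_CV n c v0 v1
  (fun xi xiI => introT andP (conj (hv0 xi xiI) (hv1 xi xiI))).
have := esum_fcoef_psi t n c; set X := \sum_(r < N) _ in X0 X1 *.
under eq_esum do rewrite -Qm_Sm.
set s := (\esum_(m in _) _)%E => sE.
have ge0 m : 0 <= cabs2 (Qm R N om alpha beta t m * Sm t n c m) by exact: cabs2_ge0.
have up : (\esum_(m in [set: int]) (cabs2 (Sm t n c m))%:E <= (q0^-1 * (alpha^-1 * X))%:E)%E.
  apply: (esum_le_scale _ _ (fun m => cabs2 (Qm R N om alpha beta t m * Sm t n c m))).
  - by rewrite invr_ge0 ltW.
  - exact: ge0.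
  - move=> m; rewrite cabs2M mulrA ler_peMl ?cabs2_ge0//.
    by rewrite mulrC ler_pdivlMr// mul1r; have /andP[] := hq t m.
  - by rewrite -/s sE.
have s0 : (0 <= \esum_(m in [set: int]) (cabs2 (Sm t n c m))%:E)%E.
  by apply: esum_ge0 => m _; rewrite lee_fin cabs2_ge0.
have sfin : (\esum_(m in [set: int]) (cabs2 (Sm t n c m))%:E)%E \is a fin_num.
  by rewrite ge0_fin_numE// (le_lt_trans up)// ltry.
(* The comparison lemma needs a real bound on the sum of |Sm|^2; the upper estimate just proved
   makes that sum finite. *)
have lo : (s <= (q1 * fine (\esum_(m in [set: int]) (cabs2 (Sm t n c m))%:E)%E)%:E)%E.
  apply: (esum_le_scale _ _ (fun m => cabs2 (Sm t n c m))).
  - by rewrite ltW.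
  - by move=> m; exact: cabs2_ge0.
  - by move=> m; rewrite cabs2M ler_wpM2r ?cabs2_ge0//; have /andP[] := hq t m.
  - by rewrite fineK.
rewrite sE lee_fin in lo; split.
  rewrite -(fineK sfin) lee_fin -!mulrA ler_pdivrMl//; apply: le_trans lo.
  by rewrite ler_pM2l.
apply: le_trans up _; rewrite lee_fin -!mulrA ler_pM2l ?invr_gt0// ler_pM2l//.
Qed.

End FiberBounds.

(** * Sums over the integers and their exchange with integrals *)

Section IntegerSums.
Variable R : realType.
Local Notation mu := (@lebesgue_measure R).

(** The order 0, -1, 1, -2, ... turns unordered sums over the integers into series, to which
    monotone convergence applies. *)
Definition int_enum (i : nat) : int := if odd i then Negz i./2 else Posz i./2.

Lemma int_enum_bij : set_bij [set: nat] [set: int] int_enum.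
Proof.
split=> // [i j _ _|[n|n] _].
- rewrite -{2}(odd_double_half i) -{2}(odd_double_half j) /int_enum.
  by case: ifP; case: ifP => _ _ // [->].
- by exists n.*2 => //; rewrite /int_enum odd_double doubleK.
- by exists n.*2.+1 => //; rewrite /int_enum /= odd_double /= uphalf_double.
Qed.

Lemma esum_intE (u : int -> \bar R) : (forall m, 0 <= u m)%E ->
  (\esum_(m in [set: int]) u m = \sum_(i <oo) u (int_enum i))%E.
Proof. move=> u0; rewrite (reindex_esum [set: nat] [set: int] int_enum u int_enum_bij).
by rewrite nneseries_esumT. Qed.

Lemma esumZ (k : R) (u : int -> \bar R) : (forall m, 0 <= u m)%E -> 0 <= k ->
  (\esum_(m in [set: int]) (k%:E * u m) = k%:E * \esum_(m in [set: int]) u m)%E.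
Proof.
by move=> u0 k0; rewrite !esum_intE// ?nneseriesZl// => m; rewrite mule_ge0.
Qed.

Section Exchange.
Variables (D : set (measurableTypeR R)) (f : int -> R -> R).
Hypotheses (mD : measurable D) (mf : forall m, measurable_fun D (f m))
  (f0 : forall m t, 0 <= f m t).

Let integral_series : (\int[mu]_(t in D) (\sum_(i <oo) (f (int_enum i) t)%:E) =
  \esum_(m in [set: int]) \int[mu]_(t in D) (f m t)%:E)%E.
Proof.
rewrite esum_intE; last by move=> m; apply: integral_ge0 => t _; rewrite lee_fin.
rewrite integral_nneseries//.
- by move=> i; apply/measurable_EFinP.
- by move=> i t _; rewrite lee_fin.
Qed.

Let measurable_series : measurable_fun D (fun t => \sum_(i <oo) (f (int_enum i) t)%:E)%E.
Proof.
apply: ge0_emeasurable_sum => [i t _ _|i _]; first by rewrite lee_fin.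
exact/measurable_EFinP.
Qed.

Lemma le_integral_esum (l : R -> R) : measurable_fun D l -> (forall t, 0 <= l t) ->
  (forall t, D t -> ((l t)%:E <= \esum_(m in [set: int]) (f m t)%:E)%E) ->
  (\int[mu]_(t in D) (l t)%:E <= \esum_(m in [set: int]) \int[mu]_(t in D) (f m t)%:E)%E.
Proof.
move=> ml l0 lf; rewrite -integral_series; apply: ge0_le_integral => //.
- by move=> t _; rewrite lee_fin.
- exact/measurable_EFinP.
- by move=> t Dt; rewrite -(esum_intE (fun m => (f m t)%:E)) ?lf// => m; rewrite lee_fin.
Qed.

Lemma ge_integral_esum (u : R -> R) : measurable_fun D u ->
  (forall t, D t -> (\esum_(m in [set: int]) (f m t)%:E <= (u t)%:E)%E) ->
  (\esum_(m in [set: int]) \int[mu]_(t in D) (f m t)%:E <= \int[mu]_(t in D) (u t)%:E)%E.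
Proof.
move=> ml lf; rewrite -integral_series; apply: ge0_le_integral => //.
- by move=> t _; apply: nneseries_ge0 => i _ _; rewrite lee_fin.
- exact/measurable_EFinP.
- by move=> t Dt; rewrite -(esum_intE (fun m => (f m t)%:E)) ?lf// => m; rewrite lee_fin.
Qed.

End Exchange.
End IntegerSums.

(** * Square integrability of a simple fraction *)

Section Resolvent.
Variable R : realType.
Local Notation mu := (@lebesgue_measure R).
Variables (s : R) (om : R[i]).
Hypotheses (s0 : s != 0) (om0 : complex.Re om != 0).

Let u := complex.Re om.
Let v := complex.Im om.

Definition resolvent (y : R) : R[i] := (ci R * (s * y)%:C%C + om)^-1.

Let d (y : R) : R := u ^+ 2 + (s * y + v) ^+ 2.

Let d_gt0 y : 0 < d y.
Proof. by rewrite /d ltr_pwDl ?sqr_ge0// exprn_even_gt0. Qed.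

Lemma resolventE y : resolvent y = Complex (u / d y) (- ((s * y + v) / d y)).
Proof.
have -> : resolvent y = (Complex u (s * y + v))^-1.
  congr (_^-1); apply: complex_ext; rewrite ?cReD ?cImD ?cReM ?cImM /=.
    by rewrite mul0r mulr0 subrr add0r.
  by rewrite mul0r add0r mul1r.
by [].
Qed.

Lemma cabs2_resolvent y : cabs2 (resolvent y) = (d y)^-1.
Proof.
rewrite resolventE /cabs2 /=; have := d_gt0 y; rewrite /d => dy.
by field; rewrite gt_eqF.
Qed.

Let affine_cvg (y : R) : s * x + v @[x --> y] --> s * y + v.
Proof. by apply: cvgD; [apply: cvgM; [exact: cvg_cst|exact: cvg_id]|exact: cvg_cst]. Qed.

Let dinv_cvg (y : R) : (d x)^-1 @[x --> y] --> (d y)^-1.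
Proof.
apply: cvgV; first by rewrite gt_eqF.
apply: cvgD; first exact: cvg_cst.
by rewrite expr2; apply: cvgM; exact: affine_cvg.
Qed.

Lemma cmeas_resolvent (D : set (measurableTypeR R)) : measurable D -> cmeas D resolvent.
Proof.
move=> mD; apply: cmeas_continuous => // y.
- have -> : (fun t => complex.Re (resolvent t)) = (fun t => u * (d t)^-1).
    by apply/funext => t; rewrite resolventE.
  by apply: cvgM; [exact: cvg_cst|exact: dinv_cvg].
- have -> : (fun t => complex.Im (resolvent t)) = (fun t => - ((s * t + v) * (d t)^-1)).
    by apply/funext => t; rewrite resolventE.
  by apply: cvgN; apply: cvgM; [exact: affine_cvg|exact: dinv_cvg].
Qed.

Lemma cabs2_resolvent_le y : cabs2 (resolvent y) <= (u ^+ 2)^-1.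
Proof.
rewrite cabs2_resolvent lef_pV2 ?posrE//; last by rewrite exprn_even_gt0.
by rewrite lerDl sqr_ge0.
Qed.

Lemma integral_oneDsqr : (\int[mu]_(x in setT) (oneDsqr x)^-1%:E < +oo)%E.
Proof.
rewrite (ge0_symfun_integralT (f := fun x => (oneDsqr x)^-1)).
- rewrite -set_itvcy integral0y_oneDsqr -EFinM; exact: ltry.
- by move=> x; rewrite invr_ge0 (le_trans ler01)// oneDsqr_ge1.
- exact: continuous_oneDsqrV.
- by move=> x; rewrite /= /oneDsqr sqrrN.
Qed.

Lemma cL2_resolvent : cL2 setT resolvent.
Proof.
split; first exact: cmeas_resolvent.
(* With this p, |resolvent|^2 = 1 / (u^2 + s^2 (t + p)^2). K times the denominator is 1 + (t + p)^2
   plus nonnegative cross terms. *)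
pose p := v / s; pose K := (u ^+ 2)^-1 + (s ^+ 2)^-1.
have u2 : 0 < u ^+ 2 by rewrite exprn_even_gt0.
have s2 : 0 < s ^+ 2 by rewrite exprn_even_gt0.
have K0 : 0 <= K by rewrite addr_ge0// invr_ge0 ltW.
have m1 : measurable_fun setT (fun x : measurableTypeR R => (oneDsqr x)^-1).
  by apply: continuous_measurable_fun; exact: continuous_oneDsqrV.
have o0 x : 0 < oneDsqr x :> R by rewrite (lt_le_trans ltr01)// oneDsqr_ge1.
have m2 : measurable_fun setT (fun x : measurableTypeR R => (oneDsqr (x + p))^-1).
  exact: (measurableT_comp m1 (measurable_translate R p)).
apply: (@le_lt_trans _ _ (\int[mu]_(x in setT) (K * (oneDsqr (x + p))^-1)%:E)%E).
  apply: ge0_le_integralR => //.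
  - by apply: measurable_cabs2; exact: cmeas_resolvent.
  - by apply: measurable_funM => //; exact: measurable_cst.
  - by move=> t _; exact: cabs2_ge0.
  - move=> t _; rewrite cabs2_resolvent ler_pdivlMr// mulrC ler_pdivrMr//.
    have -> : d t = u ^+ 2 + s ^+ 2 * (t + p) ^+ 2.
      by rewrite /d /p; field.
    have -> : K * (u ^+ 2 + s ^+ 2 * (t + p) ^+ 2) = oneDsqr (t + p) +
        (u ^+ 2 / s ^+ 2 + s ^+ 2 / u ^+ 2 * (t + p) ^+ 2).
      by rewrite /K /oneDsqr; field; rewrite s0 om0.
    rewrite lerDl; apply: addr_ge0; last (apply: mulr_ge0; last exact: sqr_ge0);
      by apply: divr_ge0; exact: sqr_ge0.
have -> : (\int[mu]_(x in setT) (K * (oneDsqr (x + p))^-1)%:E =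
    K%:E * \int[mu]_(x in setT) ((oneDsqr (x + p))^-1)%:E)%E.
  by apply: ge0_integralZlR => // t _; rewrite invr_ge0 ltW.
rewrite lte_mul_pinfty//.
have := ge0_integral_translate R p setT (fun x => (oneDsqr x)^-1) measurableT m1.
rewrite preimage_setT => <-; first exact: integral_oneDsqr.
by move=> t _; rewrite invr_ge0 ltW.
Qed.

End Resolvent.

(** * The frame inequality *)

Section Frame.
Variables (R : realType) (N : nat) (a om : 'I_N -> R[i]) (alpha beta : R).
Hypotheses (beta0 : 0 < beta) (hom : forall k, complex.Re (om k) != 0).

Local Notation ico x y := (`[x, y[%classic : set (measurableTypeR R)).
Local Notation mu := (@lebesgue_measure R).
Local Notation h := (ratfun R N a om).
Let T := beta^-1.
Let bT : beta * T = 1. Proof. by rewrite divff// gt_eqF. Qed.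
Let T0 : 0 < T. Proof. by rewrite invr_gt0. Qed.
Let mT : measurable (setT : set (measurableTypeR R)). Proof. exact: measurableT. Qed.

Let pi20 : 2 * pi != 0 :> R.
Proof. by rewrite mulf_neq0// gt_eqF// pi_gt0. Qed.

(** A translation changes only the imaginary part of om_k, so the facts on [resolvent] cover every
    time shift. *)
Lemma ratfun_shiftE s t : h (t - s) =
  \sum_k a k * resolvent R (2 * pi) (om k - ci R * (2 * pi * s)%:C%C) t.
Proof.
apply: eq_bigr => k _; congr (_ / _).
by rewrite mulrBr rmorphB mulrBr; ring.
Qed.

Let Re_shift s k : complex.Re (om k - ci R * (2 * pi * s)%:C%C) != 0.
Proof. by rewrite cReD cReN cReM /= mul0r mulr0 subrr oppr0 addr0. Qed.

Lemma cL2_ratfun s : cL2 (setT : set (measurableTypeR R)) (fun t => h (t - s)).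
Proof.
have := cL2_sum _ setT _ (index_enum 'I_N)
  (fun k t => a k * resolvent R (2 * pi) (om k - ci R * (2 * pi * s)%:C%C) t) mT.
have /[swap]/[apply] : forall k, cL2 (setT : set (measurableTypeR R))
  (fun t => a k * resolvent R (2 * pi) (om k - ci R * (2 * pi * s)%:C%C) t).
  by move=> k; apply: cL2Z => //; apply: cL2_resolvent.
by apply: eq_cL2 => t _; rewrite ratfun_shiftE.
Qed.

Lemma cabs2_ratfun : exists K, forall y, cabs2 (h y) <= K.
Proof.
exists (N%:R * \sum_k cabs2 (a k) * ((complex.Re (om k)) ^+ 2)^-1) => y.
rewrite (le_trans (cabs2_sum_le _ _ _))// ler_wpM2l//; apply: ler_sum => k _.
by rewrite cabs2M ler_wpM2l ?cabs2_ge0// cabs2_resolvent_le.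
Qed.

(** The conjugate of a Gabor atom, because [ratfun] stands for the conjugate of g. *)
Definition dual_atom (m n : int) (t : R) : R[i] :=
  h (t - alpha * m%:~R) * conjc (echar beta n t).

Lemma cL2_dual_atom m n : cL2 (setT : set (measurableTypeR R))
  (fun t => conjc (dual_atom m n t)).
Proof.
apply: (cL2_le _ _ _ _ 1 mT _ (cL2_ratfun (alpha * m%:~R))) => //.
  apply: cmeasJ => //; apply: cmeasM; first exact: cL2_meas (cL2_ratfun _).
  by apply: cmeasJ => //; exact: cmeas_echar.
by move=> t _; rewrite /dual_atom cabs2J cabs2M cabs2J cabs2_echar mulr1 mul1r.
Qed.

Definition coefficient (f : R -> R[i]) (m n : int) : R[i] :=
  cint (setT : set (measurableTypeR R)) (fun t => f t * dual_atom m n t).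

Lemma cintg_dual_atom (D : set (measurableTypeR R)) f m n : measurable D ->
  cL2 D f -> cintg D (fun t => f t * dual_atom m n t).
Proof.
move=> mD lf; have la := cL2S _ _ _ _ mT mD (@subsetT _ D) (cL2_dual_atom m n).
by apply: eq_cintg (cL2_cintg _ _ _ _ mD lf la) => // t _; rewrite conjcK.
Qed.

Definition energy (f : R -> R[i]) : \bar R :=
  (\esum_(mn in [set: int * int]) (cabs2 (coefficient f mn.1 mn.2))%:E)%E.

Lemma energyE f : (energy f = \esum_(m in [set: int]) \esum_(n in [set: int])
  (cabs2 (coefficient f m n))%:E)%E.
Proof.
rewrite (esum_esum (I := [set: int]) (J := fun=> [set: int])
  (a := fun m n => (cabs2 (coefficient f m n))%:E)).
  by apply/esym; congr esum; apply/seteqP; split.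
by move=> m n _ _; rewrite lee_fin cabs2_ge0.
Qed.

Section CompactSupport.
Variables (f : R -> R[i]) (x0 : R) (n : nat).
Hypotheses (lf : cL2 (setT : set (measurableTypeR R)) f)
  (sf : forall t, ~ ico x0 (x0 + n%:R * T) t -> f t = 0).

Local Notation D := (ico x0 (x0 + T)).

Definition fiber (t : R) (j : 'I_n) : R[i] := f (t + j%:R * T).

Definition Phi (m : int) (t : R) : R[i] := Sm R N a om alpha beta t n (fiber t) m.

Let mD : measurable D. Proof. exact: measurable_itvT. Qed.
Let lfn : cL2 (ico x0 (x0 + n%:R * T)) f.
Proof. by apply: cL2S lf => //; exact: measurable_itvT. Qed.

Let cmeas_tr (F : R -> R[i]) s : cmeas setT F -> cmeas setT (fun t => F (t + s)).
Proof.
have mt := measurable_translate R s.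
by move=> [mr mi]; split; [exact: (measurableT_comp mr mt)|exact: (measurableT_comp mi mt)].
Qed.

Lemma cL2_fiber j : cL2 D (fun t => fiber t j).
Proof.
have [l _] := cL2_pieces R x0 T n f (ltW T0) (cL2_meas _ _ _ lf) lfn.
exact: (l j).
Qed.

Lemma nsq_fiber : nsq setT f = \sum_j nsq D (fun t => fiber t j).
Proof.
have [_ <-] := cL2_pieces R x0 T n f (ltW T0) (cL2_meas _ _ _ lf) lfn.
by apply: nsq_supp => // t _; exact: sf.
Qed.

Lemma cL2_Phi m : cL2 D (Phi m).
Proof.
apply: cL2_sum => // j; have [K hK] := cabs2_ratfun.
have mh : cmeas D (fun t => h (t + j%:R * T - alpha * m%:~R)).
  apply: (cmeasS _ setT) => //.
  by have := cmeas_tr _ (j%:R * T) (cL2_meas _ _ _ (cL2_ratfun (alpha * m%:~R))).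
by apply: eq_cL2 (cL2_bndM _ _ _ _ K mD (cL2_fiber j) mh _) => // t _; rewrite mulrC.
Qed.

(** The character has period T, so folding the integral onto one period leaves it as a common factor
    and gathers the translates of f times the window into [Sm]. *)
Lemma coefficientE m k : coefficient f m k = fcoef beta T x0 (Phi m) k.
Proof.
pose G t := f t * dual_atom m k t.
have mG : cmeas setT G.
  exact: cintg_meas (cintg_dual_atom setT f m k mT lf).
have iG : cintg (ico x0 (x0 + n%:R * T)) G.
  by apply: cintg_dual_atom => //; exact: measurable_itvT.
rewrite /coefficient (cint_supp _ _ (ico x0 (x0 + n%:R * T)))//; last first.
  by move=> t _ /sf ->; rewrite mul0r.
have [iGj ->] := cint_pieces R x0 T n G (ltW T0) mG iG.
rewrite /fcoef -cint_sum//; apply: eq_cint => t _.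
rewrite /Phi /Sm mulr_suml; apply: eq_bigr => j _.
rewrite /G /dual_atom (echar_shift _ beta T k t j%:Z bT).
by rewrite /fiber mulrA.
Qed.

Lemma energy_Phi : (energy f = T%:E * \esum_(m in [set: int]) (nsq D (Phi m))%:E)%E.
Proof.
rewrite energyE -esumZ; [|by move=> m; rewrite lee_fin nsq_ge0|exact: ltW].
apply: eq_esum => m _.
under eq_esum do rewrite coefficientE.
by rewrite parseval//; exact: cL2_Phi.
Qed.

Lemma frame_compact A B : 0 <= A -> 0 <= B ->
  (forall (t : R) (c : 'I_n -> R[i]),
  ((A * \sum_j cabs2 (c j))%:E <=
     \esum_(m in [set: int]) (cabs2 (Sm R N a om alpha beta t n c m))%:E)%E /\
  (\esum_(m in [set: int]) (cabs2 (Sm R N a om alpha beta t n c m))%:E <=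
     (B * \sum_j cabs2 (c j))%:E)%E) ->
  ((T * A * nsq setT f)%:E <= energy f)%E /\ (energy f <= (T * B * nsq setT f)%:E)%E.
Proof.
move=> A0 B0 hAB.
have mPhi m := measurable_cabs2 _ _ _ (cL2_meas _ _ _ (cL2_Phi m)).
have mfib j := measurable_cabs2 _ _ _ (cL2_meas _ _ _ (cL2_fiber j)).
have iE : (\esum_(m in [set: int]) (nsq D (Phi m))%:E =
    \esum_(m in [set: int]) \int[mu]_(t in D) (cabs2 (Phi m t))%:E)%E.
  by apply: eq_esum => m _; rewrite nsqE//; exact: cL2_Phi.
pose e (t : R) := \sum_j cabs2 (fiber t j).
have me : measurable_fun D e.
  by apply: measurable_sum => j.
have e0 t : 0 <= e t by apply: sumr_ge0 => j _; exact: cabs2_ge0.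
have mZ (q : R) : measurable_fun D (fun t => q * e t).
  by apply: measurable_funM => //; exact: measurable_cst.
have eE (q : R) : 0 <= q ->
    (\int[mu]_(t in D) (q * e t)%:E = (q * nsq setT f)%:E)%E.
  move=> q0; rewrite ge0_integralZlR// nsq_fiber EFinM; congr (_ * _)%E.
  rewrite /e; under eq_integral do rewrite -sumEFin.
  rewrite ge0_integral_sum//.
  - by rewrite -sumEFin; apply: eq_bigr => j _; rewrite nsqE//; exact: cL2_fiber.
  - by move=> j; exact/measurable_EFinP.
  - by move=> j t _; rewrite lee_fin cabs2_ge0.
rewrite energy_Phi iE -!mulrA; split.
  rewrite EFinM lee_pmul2l ?lte_fin// -eE//.
  apply: le_integral_esum => //.
  - by move=> m t; exact: cabs2_ge0.
  - by move=> t; rewrite mulr_ge0.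
  - by move=> t _; have [] := hAB t (fiber t).
rewrite EFinM lee_pmul2l ?lte_fin// -eE//.
apply: ge_integral_esum => //.
- by move=> m t; exact: cabs2_ge0.
- by move=> t _; have [] := hAB t (fiber t).
Qed.

End CompactSupport.
End Frame.

(** * From compact support to all of L2 *)

Section FrameAllL2.
Variables (R : realType) (N : nat) (a om : 'I_N -> R[i]) (alpha beta : R).
Hypotheses (N0 : (0 < N)%N) (alpha0 : 0 < alpha) (beta0 : 0 < beta)
  (abN : alpha * beta * N%:R <= 1) (ha : forall k, a k != 0)
  (hom : forall k, complex.Re (om k) != 0)
  (homd : forall k l, k != l -> complex.Re (om k) != complex.Re (om l)).

Local Notation ico x y := (`[x, y[%classic : set (measurableTypeR R)).
Local Notation mu := (@lebesgue_measure R).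
Local Notation ST := (setT : set (measurableTypeR R)).
Local Notation coef := (coefficient R N a om alpha beta).
Local Notation energy := (energy R N a om alpha beta).
Let T := beta^-1.
Let T0 : 0 < T. Proof. by rewrite invr_gt0. Qed.
Let mT : measurable ST. Proof. exact: measurableT. Qed.

(** Bounds on the energy are handled through finite lists of indices, since finite sums pass to the
    limit in the cut-off. *)
Lemma energy_ub f X : (forall J : seq (int * int), uniq J ->
    \sum_(mn <- J) cabs2 (coef f mn.1 mn.2) <= X) -> (energy f <= X%:E)%E.
Proof.
move=> h; apply: ge_ereal_sup => _ [A [fA _] <-].
by rewrite fsbig_finite// sumEFin lee_fin; apply: h; exact: finmap.fset_uniq.
Qed.

Lemma energy_lb f X (J : seq (int * int)) : (energy f <= X%:E)%E -> uniq J ->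
  \sum_(mn <- J) cabs2 (coef f mn.1 mn.2) <= X.
Proof.
move=> eX uJ; rewrite -lee_fin; apply: le_trans eX; apply: ereal_sup_ubound.
exists [set` J]; first by split => //; exact: finite_seq.
by rewrite -fsbig_seq// sumEFin.
Qed.

(** The interval [-M T, M T), written as a starting point plus a natural number of periods to fit
    [frame_compact]. *)
Definition window (M : nat) : set (measurableTypeR R) :=
  ico (- (M%:R * T)) (- (M%:R * T) + (M + M)%N%:R * T).

Definition cut (f : R -> R[i]) (M : nat) (t : R) : R[i] := f t * cindic R (window M) t.

Lemma windowP t : \forall M \near \oo, window M t.
Proof.
near=> M; have : `|t| / T < M%:R by near: M; exact: nbhs_infty_gtr.
rewrite ltr_pdivrMr// ltr_norml => /andP[h1 h2].
rewrite /window /= in_itv /= natrD mulrDl addKr.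
by rewrite ltW.
Unshelve. all: by end_near. Qed.

Lemma cut_cvg f t : \forall M \near \oo, cut f M t = f t.
Proof.
near=> M; have wt : window M t by near: M; exact: windowP.
by rewrite /cut /cindic indicE mem_set// mulr1.
Unshelve. all: by end_near. Qed.

Lemma cutE f M t : cut f M t = f t \/ cut f M t = 0.
Proof.
by rewrite /cut /cindic indicE; case: (_ \in _); [left; rewrite mulr1|right; rewrite mulr0].
Qed.

Section OneFunction.
Variable f : R -> R[i].
Hypothesis lf : cL2 ST f.

Lemma cL2_cut M : cL2 ST (cut f M).
Proof.
apply: (cL2_le _ _ f _ 1) => //.
  apply: cmeasM; first exact: cL2_meas lf.
  by apply: cmeas_indic; exact: measurable_itvT.
by move=> t _; have [->|->] := cutE f M t; rewrite mul1r// cabs20 cabs2_ge0.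
Qed.

Lemma cL2_tail M : cL2 ST (fun t => f t - cut f M t).
Proof.
apply: eq_cL2 (cL2D _ _ _ _ mT lf (cL2Z _ _ _ (-1) mT (cL2_cut M))) => t _.
by rewrite mulN1r.
Qed.

Lemma cvg_nsq_cut : nsq ST (cut f M) @[M --> \oo] --> nsq ST f.
Proof.
have [|M t _|_ //] := Rintegral_dominated R ST (fun M t => cabs2 (cut f M t))
  (fun t => cabs2 (f t)) _ mT (fun M => measurable_cabs2 _ _ _ (cL2_meas _ _ _ (cL2_cut M)))
  (measurable_cabs2 _ _ _ (cL2_meas _ _ _ lf)) _ (cL2_integrable _ _ _ mT lf).
- apply: aeW => t _; apply: cvg_near_cst.
  by near=> M; congr cabs2; near: M; exact: cut_cvg.
- rewrite ger0_norm ?cabs2_ge0//.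
  by have [->|->] := cutE f M t; rewrite // cabs20 cabs2_ge0.
Unshelve. all: by end_near. Qed.

Lemma cvg_nsq_tail : nsq ST (fun t => f t - cut f M t) @[M --> \oo] --> (0 : R).
Proof.
have [|M t _|_] := Rintegral_dominated R ST (fun M t => cabs2 (f t - cut f M t))
  (fun=> 0) _ mT (fun M => measurable_cabs2 _ _ _ (cL2_meas _ _ _ (cL2_tail M)))
  (measurable_cst (0 : R)) _ (cL2_integrable _ _ _ mT lf).
- apply: aeW => t _; apply: cvg_near_cst.
  near=> M; have -> : cut f M t = f t by near: M; exact: cut_cvg.
  by rewrite subrr cabs20.
- rewrite ger0_norm ?cabs2_ge0//.
  by have [->|->] := cutE f M t; rewrite ?subr0// subrr cabs20 cabs2_ge0.
- by rewrite /Rintegral integral0.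
Unshelve. all: by end_near. Qed.

Lemma cvg_coef_cut m n : cabs2 (coef (cut f M) m n) @[M --> \oo] --> cabs2 (coef f m n).
Proof.
have iF := cintg_dual_atom R N a om alpha beta hom _ f m n mT lf.
have iM M := cintg_dual_atom R N a om alpha beta hom _ _ m n mT (cL2_cut M).
have mF := cintg_meas _ _ _ iF; have mM M := cintg_meas _ _ _ (iM M).
rewrite /cabs2; apply: cvgD; rewrite expr2.
  suff c : complex.Re (coef (cut f M) m n) @[M --> \oo] --> complex.Re (coef f m n).
    by apply: cvgM.
  have [|M t _|_ //] := Rintegral_dominated R ST
    (fun M t => complex.Re (cut f M t * dual_atom R N a om alpha beta m n t))
    (fun t => complex.Re (f t * dual_atom R N a om alpha beta m n t)) _
    mT (fun M => (mM M).1) mF.1 _ (integrable_norm iF.1).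
  - apply: aeW => t _; apply: cvg_near_cst.
    by near=> M; congr (complex.Re (_ * _)); near: M; exact: cut_cvg.
  - by have [->|->] := cutE f M t; rewrite // mul0r normr0 normr_ge0.
suff c : complex.Im (coef (cut f M) m n) @[M --> \oo] --> complex.Im (coef f m n).
  by apply: cvgM.
have [|M t _|_ //] := Rintegral_dominated R ST
  (fun M t => complex.Im (cut f M t * dual_atom R N a om alpha beta m n t))
  (fun t => complex.Im (f t * dual_atom R N a om alpha beta m n t)) _
  mT (fun M => (mM M).2) mF.2 _ (integrable_norm iF.2).
- apply: aeW => t _; apply: cvg_near_cst.
  by near=> M; congr (complex.Im (_ * _)); near: M; exact: cut_cvg.
- by have [->|->] := cutE f M t; rewrite // mul0r normr0 normr_ge0.
Unshelve. all: by end_near. Qed.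

Variables A B : R.
Hypotheses (A0 : 0 <= A) (B0 : 0 <= B).
Hypothesis fiberAB : forall (t : R) n (c : 'I_n -> R[i]),
  ((A * \sum_j cabs2 (c j))%:E <=
     \esum_(m in [set: int]) (cabs2 (Sm R N a om alpha beta t n c m))%:E)%E /\
  (\esum_(m in [set: int]) (cabs2 (Sm R N a om alpha beta t n c m))%:E <=
     (B * \sum_j cabs2 (c j))%:E)%E.

Lemma energy_cut M : ((T * A * nsq ST (cut f M))%:E <= energy (cut f M))%E /\
  (energy (cut f M) <= (T * B * nsq ST (cut f M))%:E)%E.
Proof.
apply: (frame_compact R N a om alpha beta beta0 hom _ (- (M%:R * T)) (M + M)%N
  (cL2_cut M) _ A B A0 B0) => [t nw|t c]; last exact: fiberAB.
by rewrite /cut /cindic indicE memNset ?mulr0.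
Qed.

Lemma energy_upper : (energy f <= (T * B * nsq ST f)%:E)%E.
Proof.
apply: energy_ub => J uJ.
have c1 := cvg_sumR R _ J (fun mn M => cabs2 (coef (cut f M) mn.1 mn.2)) _
  (fun mn => cvg_coef_cut mn.1 mn.2).
have c2 : T * B * nsq ST (cut f M) @[M --> \oo] --> T * B * nsq ST f.
  by apply: cvgM; [exact: cvg_cst|exact: cvg_nsq_cut].
apply: (ler_cvg_to c1 c2); apply: nearW => M.
by apply: energy_lb => //; have [] := energy_cut M.
Qed.

End OneFunction.

Lemma frame_bounds : exists A B : R, [/\ 0 < A, 0 < B & forall f, cL2 ST f ->
  ((A * nsq ST f)%:E <= energy f)%E /\ (energy f <= (B * nsq ST f)%:E)%E].
Proof.
have [A [B [A0 B0 hAB]]] :=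
  fiber_bounds R N a om alpha beta N0 alpha0 beta0 abN ha hom homd.
(* The factor 1/2 is the price of |x - y|^2 <= 2 |x|^2 + 2 |y|^2 in the comparison of f with its
   cut-off. *)
exists (2^-1 * (T * A)), (T * B); split; [by rewrite !mulr_gt0 ?invr_gt0|exact: mulr_gt0|].
move=> f lf.
have up g : cL2 ST g -> (energy g <= (T * B * nsq ST g)%:E)%E.
  by move=> lg; apply: (energy_upper g lg A B (ltW A0) (ltW B0) hAB).
split; last exact: up.
have e0 : (0 <= energy f)%E by apply: esum_ge0 => mn _; rewrite lee_fin cabs2_ge0.
have efin : energy f \is a fin_num by rewrite ge0_fin_numE// (le_lt_trans (up f lf))// ltry.
(* The cut-off is f minus its tail. The energy of the tail is controlled by the upper bound, and its
   norm tends to 0. *)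
have key M : T * A * nsq ST (cut f M) <=
    2 * fine (energy f) + 2 * (T * B * nsq ST (fun t => f t - cut f M t)).
  have [lo _] := energy_cut f lf A B (ltW A0) (ltW B0) hAB M.
  rewrite -lee_fin; apply: le_trans lo _; apply: energy_ub => J uJ.
  have h1 : \sum_(mn <- J) cabs2 (coef f mn.1 mn.2) <= fine (energy f).
    by apply: energy_lb => //; rewrite fineK.
  have h2 := energy_lb _ _ J (up _ (cL2_tail f lf M)) uJ.
  apply: (@le_trans _ _ (\sum_(mn <- J) (2 * cabs2 (coef f mn.1 mn.2) +
      2 * cabs2 (coef (fun t => f t - cut f M t) mn.1 mn.2)))); last first.
    by rewrite big_split /= -!mulr_sumr lerD// ler_pM2l.
  apply: ler_sum => -[m n] _ /=.
  have -> : coef (cut f M) m n = coef f m n - coef (fun t => f t - cut f M t) m n.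
    rewrite /coefficient -cintB//.
    - by apply: eq_cint => t _; rewrite -mulrBl subKr.
    - exact: cintg_dual_atom.
    - by apply: cintg_dual_atom => //; exact: cL2_tail.
  exact: cabs2B_le.
have c1 : T * A * nsq ST (cut f M) @[M --> \oo] --> T * A * nsq ST f.
  by apply: cvgM; [exact: cvg_cst|exact: cvg_nsq_cut].
have c2 : 2 * fine (energy f) + 2 * (T * B * nsq ST (fun t => f t - cut f M t))
    @[M --> \oo] --> 2 * fine (energy f) + 2 * (T * B * 0).
  apply: cvgD; first exact: cvg_cst.
  apply: cvgM; first exact: cvg_cst.
  by apply: cvgM; [exact: cvg_cst|exact: cvg_nsq_tail].
have := ler_cvg_to c1 c2 (nearW _ key).
rewrite !mulr0 addr0 => h.
by rewrite -(fineK efin) lee_fin -mulrA ler_pdivrMl//; exact: h.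
Qed.

End FrameAllL2.

Theorem theorem1p7 (R : realType) (N : nat) (a w : 'I_N -> R[i])
  (ha : forall k, a k != 0)
  (hw : forall k, complex.Re (w k) != 0)
  (hwd : forall k l, k != l -> complex.Re (w k) != complex.Re (w l)) :
  [set ab : R * R | 0 < ab.1 /\ 0 < ab.2 /\ ab.1 * ab.2 <= N%:R^-1]
    `<=` frame_set (fun t : R => \sum_(k < N) a k / ((t%:C)%C - ci R * w k)).
Proof.
move=> [alpha beta] /= [alpha0 [beta0 abN]].
(* For N = 0 the inverse of N is 0, and no positive alpha and beta satisfy the constraint. *)
have [Nz|N0] := posnP N.
  have : alpha * beta <= 0 by rewrite (le_trans abN)// Nz invr0.
  by rewrite leNgt mulr_gt0.
pose g t := \sum_(k < N) a k / ((t%:C)%C - ci R * w k).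
pose tau : R[i] := (2 * pi)%:C%C.
(* The conjugate of a / (t - i w) is conj(a) / (t + i conj(w)); multiplying numerator and
   denominator by 2 pi i gives the parameters [om] and [a']. *)
pose om k := - (tau * conjc (w k)).
pose a' k := ci R * tau * conjc (a k).
have pi20 : 2 * pi != 0 :> R by rewrite mulf_neq0// gt_eqF// pi_gt0.
have tau0 : tau != 0 by rewrite -cabs2_eq0 cabs2_real sqrf_eq0.
have ci0 : ci R != 0 by rewrite eq_complex /= oner_eq0 andbF.
have ReE k : complex.Re (om k) = - (2 * pi * complex.Re (w k)).
  by rewrite cReN cReM cReJ cImJ /= mul0r subr0.
have gE y : conjc (g y) = ratfun R N a' om y.
  rewrite conjc_sum; apply: eq_bigr => k _; rewrite conjcM conjc_inv conjcB conjc_real conjcM.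
  have -> : conjc (ci R) = - ci R by apply: complex_ext; rewrite /= ?oppr0.
  have -> : ci R * (2 * pi * y)%:C%C + om k = ci R * tau * (y%:C%C - - ci R * conjc (w k)).
    have cc : ci R * ci R = -1 by apply: complex_ext; rewrite /= ; ring.
    rewrite rmorphM -/tau /om.
    transitivity (ci R * tau * y%:C%C + (ci R * ci R) * (tau * conjc (w k))).
      by rewrite cc; ring.
    by ring.
  by rewrite /a' invfM mulrACA mulfV ?mul1r// mulf_neq0.
have [A [B [A0 B0 hAB]]] : exists A B : R, [/\ 0 < A, 0 < B &
    forall f, cL2 (setT : set (measurableTypeR R)) f ->
    ((A * nsq setT f)%:E <= energy R N a' om alpha beta f)%E /\
    (energy R N a' om alpha beta f <= (B * nsq setT f)%:E)%E].
  apply: frame_bounds => //.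
  - by rewrite -ler_pdivlMr ?ltr0n// div1r.
  - by move=> k; rewrite /a' !mulf_neq0// conjc_eq0.
  - by move=> k; rewrite ReE oppr_eq0 mulf_neq0.
  - by move=> k l kl; rewrite !ReE eqr_opp (inj_eq (mulfI pi20)); exact: hwd.
have innerE f m n : inner f (gabor_atom g alpha beta m n) =
    coefficient R N a' om alpha beta f m n.
  apply: eq_cint => t _; rewrite /gabor_atom /dual_atom conjcM gE.
  by rewrite [conjc (cexpi _) * _]mulrC.
(* The maximum secures A <= B, which [frame_bounds] does not assert. *)
split=> //; split=> //; exists A, (Num.max A B); split=> //; split.
  by rewrite le_max lexx.
move=> f [mr [mi fi]].
have lf : cL2 (setT : set (measurableTypeR R)) f by split.
have nE : normsq f = (nsq setT f)%:E by exact: nsqE measurableT lf.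
have [lo up] := hAB f lf.
have -> : (\esum_(mn in [set: int * int])
    (cabs2 (inner f (gabor_atom g alpha beta mn.1 mn.2)))%:E)%E =
    energy R N a' om alpha beta f.
  by apply: eq_esum => mn _; rewrite innerE.
rewrite nE; split; first by rewrite -EFinM.
apply: le_trans up _; rewrite -EFinM lee_fin ler_wpM2r ?nsq_ge0//.
by rewrite le_max lexx orbT.
Qed.
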